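(* Let $\alpha\in(0,1)$ and let $\mu$ be a probability measure with support contained in $\mathbb{Z}_+=\{0,1,2,\dots\}$ such that $\mu(\{x:x>t\})=t^{-\alpha}L(t)$ for all $t>0$, where $L$ is slowly varying at infinity. Let $V(t)=t^{\alpha}/L(t)$ for $t>0$ and $a_n=1/V^{\leftarrow}(n)$, where $V^{\leftarrow}(t)=\inf\{s>0: V(s)>t\}$. Let $q:[0,\infty)\to[0,\infty)$ be a tempering function, and for $\ell>0$ let $q_\ell(x)=q(x/\ell)$, $c_\ell=\left[\int_{[0,\infty)}q_\ell(x)\,\mu(\mathrm{d}x)\right]^{-1}$ and $\mu_\ell(\mathrm{d}x)=c_\ell q_\ell(x)\,\mu(\mathrm{d}x)$, where $c_\ell\to1$ as $\ell\to\infty$. Let $\{\ell_n\}$ be a sequence of positive numbers with $\ell_n\to\infty$, and for each $n\in\mathbb{N}$ let $X_{n1},X_{n2},\dots,X_{nn}$ be independent and identically distributed with distribution $\mu_{\ell_n}$. Let $D$ be the set of discontinuities of $q$, and assume that the Lebesgue measure of $D$ is $0$. Let $\circ$ denote the thinning operation. (1) If $a_n\ell_n\to c\in(0,\infty)$, then $a_n\circ\sum_{i=1}^n X_{ni}$ converges in distribution to $DTS_\alpha(q_c,\alpha)$ as $n\to\infty$, where $q_c(x)=q(x/c)$ for $x\ge0$. (2) If $a_n\ell_n\to\infty$, then $a_n\circ\sum_{i=1}^n X_{ni}$ converges in distribution to $DS_\alpha(\alpha)$ as $n\to\infty$. (3) If $a_n\ell_n\to0$ and $\lim_{x\to\infty}q(x)=\zeta<\infty$,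 then $a_n\circ\sum_{i=1}^n X_{ni}$ converges in distribution to $DS_\alpha(\alpha\zeta)$ as $n\to\infty$.
   Context: A function $f$ is regularly varying (at infinity) with index $\beta$ if $\lim_{t\to\infty}f(xt)/f(t)=x^\beta$ for every $x>0$; slowly varying means $\beta=0$. Thinning: for $\gamma\in[0,1]$ and a random variable $X$ with values in $\mathbb{Z}_+$, $\gamma\circ X$ denotes a random variable with the distribution of $\sum_{i=1}^X\epsilon_i$, where $\epsilon_1,\epsilon_2,\dots$ are iid, independent of $X$, with $P(\epsilon_i=1)=1-P(\epsilon_i=0)=\gamma$ (an empty sum is $0$). For a Borel measure $M$ on $(0,\infty)$ with $\int_{(0,\infty)}(x\wedge1)M(\mathrm{d}x)<\infty$, $ID_+(M,0)$ denotes the infinitely divisible distribution on $[0,\infty)$ with Laplace transform $z\mapsto\exp\{-\int_{(0,\infty)}(1-e^{-zx})M(\mathrm{d}x)\}$, $z\ge0$. A tempering function (for the given $\alpha\in(0,1)$) is a bounded, non-negative Borel function $q:[0,\infty)\to[0,\infty)$ with $\lim_{x\downarrow0}q(x)=1$ and $\int_0^\infty(1\wedge x)q(x)x^{-1-\alpha}\,\mathrm{d}x<\infty$. For such $q$ and $\eta\ge0$, the positive tempered stable distribution $PTS_\alpha(q,\eta)$ is $ID_+(M,0)$ with $M(\mathrm{d}x)=\eta q(x)x^{-1-\alpha}1_{x>0}\,\mathrm{d}x$. The discrete tempered stable distribution $DTS_\alpha(q,\eta)$ is the distribution of $N_T$, where $T\sim PTS_\alpha(q,\eta)$ and $\{N_t:t\ge0\}$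 is a Poisson process with rate $1$ independent of $T$. For $\alpha\in(0,1)$ and $\eta\ge0$, the discrete stable distribution $DS_\alpha(\eta)$ is the distribution on $\mathbb{Z}_+$ with probability generating function $s\mapsto\exp\{-\eta\frac{\Gamma(1-\alpha)}{\alpha}(1-s)^\alpha\}$, $|s|\le1$. The quantities $a_n$, $c_{\ell_n}$ and $\mu_{\ell_n}$ and the thinning $a_n\circ$ are only needed for $n$ large enough that they are well defined (i.e. $V^{\leftarrow}(n)>0$, $a_n\le1$ and $\int q_{\ell_n}\,\mathrm{d}\mu>0$). *)

(* Defs.v *)
From HB Require Import structures.
From mathcomp Require Import all_boot all_order all_algebra.
From mathcomp Require Import all_classical all_reals all_analysis.

Set Implicit Arguments.
Unset Strict Implicit.
Unset Printing Implicit Defensive.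

Import Order.TTheory GRing.Theory Num.Theory.
Import numFieldNormedType.Exports.

Local Open Scope classical_set_scope.
Local Open Scope ring_scope.

Definition regularly_varying (R : realType) (f : R -> R) (beta : R) : Prop :=
  forall x : R, 0 < x -> f (x * t) / f t @[t --> +oo] --> x `^ beta.

Definition slowly_varying (R : realType) (f : R -> R) : Prop :=
  regularly_varying f 0.

Definition gen_inverse (R : realType) (V : R -> R) (t : R) : R :=
  inf [set s : R | 0 < s /\ t < V s].

Definition Gamma_fun (R : realType) (a : R) : R :=
  \int[lebesgue_measure]_(t in `]0, +oo[) (t `^ (a - 1) * expR (- t)).

Definition mutually_independent (R : realType) (d d' : measure_display)
    (Omega : measurableType d) (S : measurableType d') (P : probability Omega R)
    (I : eqType) (X : I -> Omega -> S) : Prop :=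
  forall (J : seq I) (A : I -> set S), uniq J -> (forall i, measurable (A i)) ->
    P (\big[setI/setT]_(i <- J) (X i @^-1` A i)) =
    (\prod_(i <- J) P (X i @^-1` A i))%E.

(* The sigma-algebra generated by X is independent of the one generated by the
   variables Y i, i in D, taken jointly. *)
Definition independent_of_family (R : realType) (d d' d'' : measure_display)
    (Omega : measurableType d) (S : measurableType d') (S' : measurableType d'')
    (P : probability Omega R) (X : Omega -> S)
    (I : Type) (D : set I) (Y : I -> Omega -> S') : Prop :=
  forall (B : set S) (A : set Omega), measurable B ->
    <<s \bigcup_(i in D) [set Y i @^-1` C | C in measurable] >> A ->
    P (X @^-1` B `&` A) = (P (X @^-1` B) * P A)%E.

(* Convergence in distribution of nat-valued variables, possibly living on
   different probability spaces; nat is embedded in R. *)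
Definition cvg_in_distribution (R : realType) (d : nat -> measure_display)
    (Omega : forall n, measurableType (d n))
    (P : forall n, probability (Omega n) R) (Y : forall n, Omega n -> nat)
    (nu : probability nat R) : Prop :=
  forall f : R -> R, continuous f -> (exists C : R, forall x, `|f x| <= C) ->
    \int[P n]_w f (Y n w)%:R @[n --> \oo] --> \int[nu]_k f k%:R.

(* eps is indexed from 0: eps i is the variable usually written epsilon_(i+1). *)
Definition thinning_noise (R : realType) (d : measure_display)
    (Omega : measurableType d) (P : probability Omega R) (gamma : R)
    (X : Omega -> nat) (eps : nat -> {RV P >-> nat}) : Prop :=
  [/\ forall i, P (eps i @^-1` [set 1%N]) = gamma%:E,
      forall i, P (eps i @^-1` [set 0%N]) = (1 - gamma)%:E,
      mutually_independent P (fun i => eps i : Omega -> nat) &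
      independent_of_family P X setT (fun i => eps i : Omega -> nat)].

Definition thin (Omega : Type) (X : Omega -> nat) (eps : nat -> Omega -> nat)
    (w : Omega) : nat :=
  (\sum_(i < X w) eps i w)%N.

(* Functions on [0, +oo[ are represented by functions R -> R whose values on
   ]-oo, 0[ are never used. *)

Definition tempering_function (R : realType) (alpha : R) (q : R -> R) : Prop :=
  [/\ measurable_fun (`[0, +oo[ : set R) q,
      forall x, 0 <= x -> 0 <= q x,
      exists C : R, forall x, 0 <= x -> q x <= C,
      q x @[x --> 0^'+] --> (1 : R) &
      (\int[lebesgue_measure]_(x in `]0%R, +oo[)
         (Num.min 1 x * q x * x `^ (- 1 - alpha))%:E < +oo)%E].

(* Continuity is relative to the domain [0, +oo[, which matters only at 0. *)
Definition discontinuities (R : realType) (q : R -> R) : set R :=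
  [set x : R | 0 <= x /\ ~ (q y @[y --> within (`[0, +oo[ : set R) (nbhs x)] --> q x)].

Definition rescale (R : realType) (q : R -> R) (l : R) : R -> R :=
  fun x => q (x / l).

Definition temper_const (R : realType) (mu : probability nat R) (q : R -> R)
    (l : R) : R :=
  (\int[mu]_k rescale q l k%:R)^-1.

Definition tempered (R : realType) (mu : probability nat R) (q : R -> R) (l : R)
    (A : set nat) : \bar R :=
  ((temper_const mu q l)%:E * \int[mu]_(k in A) (rescale q l k%:R)%:E)%E.

(* M is a measure on R of which only the restriction to ]0, +oo[ matters. *)
Definition is_ID_plus (R : realType) (M : {measure set R -> \bar R})
    (nu : probability R R) : Prop :=
  [/\ (\int[M]_(x in `]0%R, +oo[) (Num.min x 1)%:E < +oo)%E,
      nu [set x | 0 <= x] = 1%E &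
      forall z : R, 0 <= z ->
        \int[nu]_(x in `[0, +oo[) expR (- (z * x)) =
        expR (- \int[M]_(x in `]0, +oo[) (1 - expR (- (z * x))))].

Definition is_PTS (R : realType) (alpha : R) (q : R -> R) (eta : R)
    (nu : probability R R) : Prop :=
  exists M : {measure set R -> \bar R},
    (forall A : set R, measurable A ->
       M A = (\int[lebesgue_measure]_(x in A `&` `]0%R, +oo[)
                (eta * q x * x `^ (- 1 - alpha))%:E)%E) /\
    is_ID_plus M nu.

(* The truncated subtraction in the increments is harmless, paths being
   nondecreasing.  The second argument of poisson_prob is a dummy, and
   poisson_prob 0 _ is the Dirac measure at 0. *)
Definition unit_poisson_process (R : realType) (d : measure_display)
    (Omega : measurableType d) (P : probability Omega R)
    (N : R -> {RV P >-> nat}) : Prop :=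
  [/\ forall w, N 0 w = 0%N,
      forall w s t, 0 <= s -> s <= t -> (N s w <= N t w)%N,
      forall w t, 0 <= t -> \forall s \near t^'+, N s w = N t w,
      forall s t, 0 <= s -> s <= t -> forall A : set nat,
        P [set w | A (N t w - N s w)%N] = poisson_prob (t - s) 0%N A &
      forall t : nat -> R, 0 <= t 0%N -> (forall i, t i <= t i.+1) ->
        mutually_independent P (fun (i : nat) w => (N (t i.+1) w - N (t i) w)%N)].

Definition is_DTS (R : realType) (alpha : R) (q : R -> R) (eta : R)
    (nu : probability nat R) : Prop :=
  exists (d : measure_display) (Omega : measurableType d)
         (P : probability Omega R) (T : {RV P >-> R}) (N : R -> {RV P >-> nat}),
    [/\ forall w, 0 <= T w,
        is_PTS alpha q eta (distribution P T),
        unit_poisson_process N,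
        independent_of_family P T [set t | 0 <= t]
          (fun t => N t : Omega -> nat) &
        forall A : set nat, nu A = P [set w | A (N (T w) w)]].

(* The probability generating function is taken on real arguments s. *)
Definition is_DS (R : realType) (alpha eta : R) (nu : probability nat R) : Prop :=
  forall s : R, `|s| <= 1 ->
    \int[nu]_k (s ^+ k) =
    expR (- (eta * (Gamma_fun (1 - alpha) / alpha) * (1 - s) `^ alpha)).

(* Main.v *)
Require Import Defs.
From HB Require Import structures.
From mathcomp Require Import all_boot all_order all_algebra ring lra.
From mathcomp Require Import all_classical all_reals all_analysis measurable_realfun.

Set Implicit Arguments.
Unset Strict Implicit.
Unset Printing Implicit Defensive.

Import Order.TTheory GRing.Theory Num.Theory.
Import numFieldNormedType.Exports.

Local Open Scope classical_set_scope.
Local Open Scope ring_scope.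

(** Everything is reduced to generating functions on ]0, 1[.  Given the sum [S n],
    the thinned variable is a sum of [S n] Bernoulli variables of parameter
    [a n = (b n)^-1], so for [u = 1 - s] its generating function at [s] is
      [(E (1 - u / b n) ^+ X) ^+ n = (1 - c_n * I_n) ^+ n],
    where [c_n] is the normalizing constant of the tempered law and [I_n] is
    the integral of [q (k / ell n) * (1 - (1 - u / b n) ^+ k)] against [mu].
    Since [c_n] tends to 1, the point is the limit of [n * I_n]; if it is [l],
    the generating function tends to [expR (- l)].

    The limit of [n * I_n] is an instance of the vague convergence of [n] times
    the law of [X / b n] to the measure [alpha * x `^ (- 1 - alpha) dx].  It is
    obtained by a change of variable instead.  Let [F] be the tail of [mu] and
    [Q n v] the generalized inverse of [n * F].  Then [n * \int h dmu] is the
    Lebesgue integral of [h (Q n v)] over [v > 0]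
    ([integral_tail_quantile]), and regular variation of [F] gives
    [Q n v / b n --> v `^ (- alpha^-1)] for every [v] ([tail_quantile_cvg]).
    A Potter bound dominates [Q n v / b n] by a constant multiple of
    [v `^ (- beta^-1)] with [alpha < beta < 1] ([tail_quantile_dom]), which is
    integrable at infinity, so dominated convergence applies
    ([tail_quantile_integral_cvg]).  The three cases of the theorem differ only
    in the limit of [q (Q n v / ell n)]: as [ell n / b n] tends to [c], to
    infinity or to 0, this limit is [q (v `^ (- alpha^-1) / c)] for almost every
    [v], the limit 1 of [q] at 0, or its limit [zeta] at infinity.

    On the side of the limit laws, the substitution [x = v `^ (- alpha^-1)]
    ([integral_power_subst]) identifies the resulting exponent with the one of
    the tempered stable law, and a Fubini argument ([stable_exponent]) with
    [Gamma (1 - alpha) * u `^ alpha] when [q] is replaced by 1.  A Poisson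
    process at an independent time [T] has generating function
    [E expR (- (1 - s) * T)] ([pgf_poisson_time]).  Finally, convergence of
    generating functions to that of a probability measure gives convergence in
    distribution ([pgf_cvg_integral]). *)

(** * Laws on the natural numbers and their generating functions *)

Lemma integral_nat_series (R : realType) (m : {measure set nat -> \bar R})
    (f : nat -> \bar R) :
  (forall k, 0 <= f k)%E ->
  (\int[m]_k f k = \sum_(0 <= k <oo) f k * m [set k])%E.
Proof.
move=> f0.
have -> : [set: nat] = \bigcup_k [set k].
  by apply/seteqP; split=> // k _; exists k.
rewrite ge0_integral_bigcup//.
  apply: eq_eseriesr => k _.
  rewrite (@eq_integral _ _ _ m [set k] (fun=> f k)) ?integral_cst//.
  by move=> x; rewrite inE => ->.
by move=> i j _ _ [x [/= -> ->]].
Qed.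

Section NatLaws.
Context {R : realType}.
Implicit Types (m : probability nat R) (f : nat -> R).

Lemma integrable_bounded_prob (C : R) d (T : measurableType d) (P : probability T R)
    (D : set T) (f : T -> R) :
  measurable D -> measurable_fun D f -> (forall x, D x -> `|f x| <= C) ->
  P.-integrable D (EFin \o f).
Proof.
move=> mD mf fC; apply: measurable_bounded_integrable => //.
- by rewrite (le_lt_trans (probability_le1 P mD))// ltry.
- exists C; split; first exact: num_real.
  by move=> M CM x Dx; apply: (le_trans (fC _ Dx)); exact: ltW.
Qed.

Lemma Rintegral_nat_split m f (C : R) (j : nat) : (forall k, `|f k| <= C) ->
  \int[m]_(k in [set k | (j <= k)%N]) f k =
  f j * fine (m [set j]) + \int[m]_(k in [set k | (j < k)%N]) f k.
Proof.
move=> fC.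
have -> : [set k | (j <= k)%N] = [set j] `|` [set k | (j < k)%N].
  apply/seteqP; split=> k /=; rewrite [(j <= k)%N]leq_eqVlt.
    by move=> /orP[/eqP ->|]; [left|right].
  by move=> [->|->]; rewrite ?eqxx ?orbT.
rewrite Rintegral_setU//.
- congr (_ + _); rewrite -Rintegral_cst//; apply: eq_Rintegral => k.
  by rewrite inE => ->.
- by apply: (integrable_bounded_prob m (C:=C)) => // x _; exact: fC.
- by apply/disj_setPS => k [/= ->]; rewrite ltnn.
Qed.

Lemma Rintegral_nat_sum m f (C : R) (K : nat) : (forall k, `|f k| <= C) ->
  \int[m]_k f k = \sum_(k < K) f k * fine (m [set (k : nat)]) +
                  \int[m]_(k in [set k | (K <= k)%N]) f k.
Proof.
move=> fC; elim: K => [|K ->].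
  by rewrite big_ord0 add0r; congr (Rintegral _ _ _); apply/seteqP; split.
by rewrite big_ord_recr/= -addrA (Rintegral_nat_split _ _ fC).
Qed.

Lemma mass_sum_tail m (K : nat) :
  \sum_(k < K) fine (m [set (k : nat)]) + fine (m [set k | (K <= k)%N]) = 1.
Proof.
have := @Rintegral_nat_sum m (fun=> 1) 1 K.
move=> /(_ (fun=> ltac:(by rewrite normr1))).
have mT : m setT = 1%E := probability_setT m.
rewrite !Rintegral_cst//= mT !mul1r => /= ->.
by congr (_ + _); apply: eq_bigr => k _; rewrite mul1r.
Qed.

Lemma Rintegral_prob_le (C : R) d (T : measurableType d) (P : probability T R)
    (D : set T) (f : T -> R) :
  measurable D -> measurable_fun D f -> (forall x, D x -> `|f x| <= C) ->
  `|\int[P]_(x in D) f x| <= C * fine (P D).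
Proof.
move=> mD mf fC.
have fint := integrable_bounded_prob P mD mf fC.
apply: (le_trans (le_normr_Rintegral mD fint)).
rewrite -Rintegral_cst//; apply: le_Rintegral => //.
  apply: (integrable_bounded_prob P (C:=C)) => //.
    exact: measurableT_comp.
  by move=> x /fC; rewrite normr_id.
apply: (integrable_bounded_prob P (C:=`|C|)) => //.
Qed.

Section ContinuityTheorem.
Variables (nu_ : nat -> probability nat R) (nu : probability nat R).
Hypothesis pgf_cvg : forall s : R, 0 < s -> s < 1 ->
  \int[nu_ n]_k s ^+ k @[n --> \oo] --> \int[nu]_k s ^+ k.

Let mass m k := fine (m [set k]).
Let H m j s := \int[m]_(k in [set k | (j <= k)%N]) s ^+ (k - j).

Let expr_bound (s : R) (j k : nat) : 0 < s -> s < 1 -> `|s ^+ (k - j)| <= 1.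
Proof.
by move=> s0 s1; rewrite normrX ger0_norm ?(ltW s0)// exprn_ile1// ltW.
Qed.

Let H_rec m j s : 0 < s -> s < 1 -> H m j s = mass m j + s * H m j.+1 s.
Proof.
move=> s0 s1; rewrite /H (@Rintegral_nat_split _ _ 1); last first.
  by move=> k; exact: expr_bound.
rewrite subnn expr0 mul1r; congr (_ + _).
rewrite -RintegralZl//; last first.
  by apply: (integrable_bounded_prob m (C:=1)) => // x _; exact: expr_bound.
apply: eq_Rintegral => k; rewrite inE/= => jk.
by rewrite -exprS subnSK.
Qed.

Let H_le1 m j s : 0 < s -> s < 1 -> `|H m j s| <= 1.
Proof.
move=> s0 s1; apply: (le_trans (Rintegral_prob_le m (C:=1) _ _ _)) => //.
  by move=> k _; exact: expr_bound.
by rewrite mul1r -lee_fin fineK ?fin_num_measure// probability_le1.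
Qed.

(** The power series [H m j s] equals the [j]-th mass up to an error of at most
    [s], uniformly in the law: letting [s] tend to 0 isolates the [j]-th mass,
    and subtracting it and dividing by [s] passes from [j] to [j + 1]. *)
Let mass_H_cvg j :
  (forall s, 0 < s -> s < 1 -> H (nu_ n) j s @[n --> \oo] --> H nu j s) /\
  mass (nu_ n) j @[n --> \oo] --> mass nu j.
Proof.
have HM i : (forall s, 0 < s -> s < 1 ->
    H (nu_ n) i s @[n --> \oo] --> H nu i s) ->
    mass (nu_ n) i @[n --> \oo] --> mass nu i.
  move=> Hi; apply/cvgrPdist_le => e e0.
  pose s := Num.min (e / 3) (1 / 2).
  have s0 : 0 < s by rewrite lt_min !divr_gt0.
  have s1 : s < 1 by rewrite gt_min; apply/orP; right; rewrite ltr_pdivrMr// mul1r ltr1n.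
  have se : s <= e / 3 by rewrite ge_min lexx.
  have e3 : 0 < e / 3 by rewrite divr_gt0.
  have /cvgrPdist_le/(_ _ e3) := Hi _ s0 s1; apply: filterS => n Hn.
  have b m : `|H m i s - mass m i| <= e / 3.
    rewrite H_rec// addrC addKr normrM gtr0_norm// (le_trans _ se)//.
    by rewrite ger_pMr// H_le1.
  rewrite (_ : _ - _ = (H nu i s - H (nu_ n) i s) - (H nu i s - mass nu i) +
    (H (nu_ n) i s - mass (nu_ n) i)); last first.
    by rewrite opprB !addrA; apply/eqP; rewrite -subr_eq0; apply/eqP; ring.
  rewrite (le_trans (ler_normD _ _))//.
  rewrite (le_trans (lerD (ler_normB _ _) (b _)))//.
  rewrite (le_trans (lerD (lerD Hn (b _)) (lexx _)))//.
  by rewrite -!mulrDl ler_pdivrMr// -!mulr2n -mulrSr mulr_natr.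
suff Hj : forall s, 0 < s -> s < 1 -> H (nu_ n) j s @[n --> \oo] --> H nu j s.
  by split=> //; exact: HM.
elim: j => [|j IH] s s0 s1.
  have E m : H m 0 s = \int[m]_k s ^+ k.
    rewrite /H; congr (Rintegral _ _ _); last by apply/funext => k; rewrite subn0.
    by apply/seteqP; split.
  by rewrite E; under eq_cvg do rewrite E; exact: pgf_cvg.
have E m : H m j.+1 s = s^-1 * (H m j s - mass m j).
  by rewrite [H m j s]H_rec// addrC addKr mulKf// gt_eqF.
rewrite E; under eq_cvg do rewrite E.
by apply: cvgMr; apply: cvgB; [exact: IH|exact: HM].
Qed.

(** Convergence of generating functions on ]0, 1[ gives that of every point
    mass; as the limit has total mass 1, no mass escapes to infinity, and
    integrals of bounded functions converge. *)
Lemma pgf_cvg_integral f (C : R) : (forall k, `|f k| <= C) ->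
  \int[nu_ n]_k f k @[n --> \oo] --> \int[nu]_k f k.
Proof.
move=> fC; have C0 : 0 <= C by rewrite (le_trans _ (fC 0%N)).
have tail m K : `|\int[m]_(k in [set k | (K <= k)%N]) f k| <=
    C * (1 - \sum_(k < K) mass m k).
  rewrite -(mass_sum_tail m K) addrC addKr.
  by apply: (Rintegral_prob_le m (C:=C)) => // k _; exact: fC.
have mass_sum_cvg (g : nat -> R) (K : nat) :
    \sum_(k < K) g k * mass (nu_ n) k @[n --> \oo] -->
    \sum_(k < K) g k * mass nu k.
  rewrite (_ : (fun n => _) = (fun n => \sum_(k <- index_enum 'I_K)
      g k * mass (nu_ n) k)); last by [].
  apply: cvg_big => //; first exact: add_continuous.
  by move=> k _; apply: cvgMr; have [] := mass_H_cvg k.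
have tail_cvg : C * (1 - \sum_(k < K) mass nu k) @[K --> \oo] --> (0 : R).
  rewrite -[X in _ --> X](mulr0 C); apply: cvgMr.
  have E K : 1 - \sum_(k < K) mass nu k = fine (nu [set k | (K <= k)%N]).
    by rewrite -(mass_sum_tail nu K) addrC addKr.
  under eq_cvg do rewrite E.
  apply: (fine_cvg (a := 0) (f := fun K => nu [set k | (K <= k)%N])).
  have <- : nu (\bigcap_K [set k | (K <= k)%N]) = 0%:E.
    rewrite (_ : \bigcap_K _ = set0) ?measure0//.
    by apply/seteqP; split=> // k /(_ k.+1 I)/=; rewrite ltnn.
  apply: nonincreasing_cvg_mu => //.
  - by rewrite (le_lt_trans (probability_le1 nu _))// ltry.
  - by move=> i j ij; apply/subsetPset => k /=; exact: leq_trans.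
apply/cvgrPdist_le => e e0.
have e4 : 0 < e / 4 by rewrite divr_gt0.
have [K _ /(_ K (leqnn K))/=] : \forall K \near \oo,
    C * (1 - \sum_(k < K) mass nu k) <= e / 4.
  move/cvgrPdist_le : tail_cvg => /(_ _ e4); apply: filterS => K.
  by rewrite sub0r normrN => /ler_normlW.
move=> CK.
have tail_n : \forall n \near \oo, C * (1 - \sum_(k < K) mass (nu_ n) k) <= e / 2.
  have : C * (1 - \sum_(k < K) 1 * mass (nu_ n) k) @[n --> \oo] -->
         C * (1 - \sum_(k < K) 1 * mass nu k).
    apply: cvgMr; apply: cvgB; first exact: cvg_cst.
    exact: (mass_sum_cvg (fun=> 1)).
  move=> /cvgrPdist_le/(_ _ e4); apply: filterS => n.
  rewrite !(eq_bigr _ (fun i _ => mul1r _)) distrC => /ler_normlW; rewrite lerBlDr.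
  by move=> /le_trans; apply; rewrite (le_trans (lerD (lexx _) CK))// -mulrDl; lra.
have /cvgrPdist_le/(_ _ e4) := mass_sum_cvg f K.
move: tail_n; apply: filterS2 => n tn sn.
rewrite !(@Rintegral_nat_sum _ f C K)//.
have := le_trans (tail nu K) CK; have := le_trans (tail (nu_ n) K) tn.
move: sn; rewrite /mass !ler_norml => /andP[? ?] /andP[? ?] /andP[? ?].
by apply/andP; split; lra.
Qed.
End ContinuityTheorem.
End NatLaws.

(** * Powers with negative exponents *)

Section NegativePowers.
Context {R : realType}.
Implicit Types x y r a : R.

Lemma ltr_powRN r x y : 0 < r -> 0 < x -> x < y -> y `^ (- r) < x `^ (- r).
Proof.
move=> r0 x0 xy; have y0 := lt_trans x0 xy.
rewrite !powRN ltf_pV2 ?posrE ?powR_gt0//.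
by apply: gt0_ltr_powR => //; rewrite nnegrE ltW.
Qed.

Lemma powRNK a x : 0 < a -> 0 < x -> (x `^ (- a)) `^ (- a^-1) = x.
Proof.
by move=> a0 x0; rewrite -powRrM mulrNN divff ?gt_eqF// powRr1// ltW.
Qed.

Lemma powRNKV a x : 0 < a -> 0 < x -> (x `^ (- a^-1)) `^ (- a) = x.
Proof.
by move=> a0 x0; rewrite -powRrM mulrNN mulVf ?gt_eqF// powRr1// ltW.
Qed.

Lemma powRN_lt a x y : 0 < a -> 0 < x -> 0 < y ->
  (x `^ (- a) < y) = (y `^ (- a^-1) < x).
Proof.
move=> a0 x0 y0; apply/idP/idP => h.
  rewrite -[ltRHS](powRNK a0 x0).
  by apply: ltr_powRN; rewrite ?invr_gt0// powR_gt0.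
rewrite -[ltRHS](powRNKV a0 y0).
by apply: ltr_powRN; rewrite // powR_gt0.
Qed.

Lemma powRN_gt a x y : 0 < a -> 0 < x -> 0 < y ->
  (y < x `^ (- a)) = (x < y `^ (- a^-1)).
Proof.
move=> a0 x0 y0; apply/idP/idP => h.
  rewrite -[ltLHS](powRNK a0 x0).
  by apply: ltr_powRN; rewrite ?invr_gt0.
by rewrite -[ltLHS](powRNKV a0 y0); apply: ltr_powRN.
Qed.

Lemma cvg_powRN_pinfty r : 0 < r -> x `^ (- r) @[x --> +oo] --> (0 : R).
Proof.
move=> r0; apply/cvgrPdist_lt => e e0; near=> x.
have x0 : 0 < x by near: x; exact: nbhs_pinfty_gt.
rewrite sub0r normrN ger0_norm ?powR_ge0// powRN_lt//.
Unshelve. all: by end_near. Qed.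

Lemma continuous_powR_gt0 r x : 0 < x -> {for x, continuous (@powR R ^~ r)}.
Proof.
move=> x0; apply: differentiable_continuous; apply/derivable1_diffP.
by apply: derivable_powR; rewrite in_itv/= x0.
Qed.

Lemma integral_powRN_tail r d : 0 < r -> 0 < d ->
  (\int[lebesgue_measure]_(x in `]d, +oo[) (r * x `^ (- r - 1))%:E =
   (d `^ (- r))%:E)%E.
Proof.
move=> r0 d0.
have m : measurable_fun `]d, +oo[ (fun x : R => (r * x `^ (- r - 1))%:E).
  apply/measurable_EFinP; apply: measurable_funM => //.
  by apply: measurable_funTS; exact: measurable_powR.
rewrite integral_itv_obnd_cbnd//.
have -> : (d `^ (- r))%:E = (0%:E - (- d `^ (- r))%:E)%E by rewrite sub0e -EFinN opprK.
apply: (@ge0_continuous_FTC2y _ (fun x => r * x `^ (- r - 1)) (fun x => - x `^ (- r))).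
- by move=> x dx; rewrite mulr_ge0 ?powR_ge0// ltW.
- apply: continuous_in_subspaceT => x; rewrite inE/= in_itv/= andbT => dx.
  apply: cvgMr.
  by apply: continuous_powR_gt0; exact: lt_le_trans dx.
- by rewrite -[X in _ --> X]oppr0; apply: cvgN; exact: cvg_powRN_pinfty.
- move=> x dx; apply: derivableN; apply: derivable_powR.
  by rewrite in_itv/= andbT (lt_trans d0).
- apply: cvgN; apply: cvg_at_right_filter; exact: continuous_powR_gt0.
- move=> x; rewrite in_itv/= andbT => dx.
  rewrite derive1N; last first.
    by apply: derivable_powR; rewrite in_itv/= andbT (lt_trans d0).
  rewrite powR_derive1; first by rewrite mulNr opprK.
  by rewrite in_itv/= andbT (lt_trans d0).
Qed.

End NegativePowers.

(** * Measures with a density *)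

Section DensityMeasure.
Context d (T : measurableType d) (R : realType).
Variables (mu : {measure set T -> \bar R}) (w : T -> R).
Hypotheses (mw : measurable_fun setT w) (w0 : forall x, 0 <= w x).

(** The proofs [mw] and [w0] are arguments of the function so that the measure
    structure on it can be inferred. *)
Definition density_measure (mw : measurable_fun setT w)
    (w0 : forall x, 0 <= w x) (A : set T) : \bar R :=
  (\int[mu]_(x in A) (w x)%:E)%E.

Let nu := density_measure mw w0.

Let nu0 : nu set0 = 0%E.
Proof. by rewrite /nu /density_measure integral_set0. Qed.

Let nu_ge0 A : (0 <= nu A)%E.
Proof. by apply: integral_ge0 => x _; rewrite lee_fin. Qed.

Let nu_sigma_additive : semi_sigma_additive nu.
Proof.
move=> /= F mF tF mUF; rewrite /nu /density_measure; apply: cvg_toP.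
  apply: ereal_nondecreasing_is_cvgn => m n mn.
  by apply: lee_sum_nneg_natr => // k _ _; apply: integral_ge0 => x _; rewrite lee_fin.
rewrite ge0_integral_bigcup//=; last by move=> x _; rewrite lee_fin.
exact/measurable_funTS/measurable_EFinP.
Qed.

HB.instance Definition _ := isMeasure.Build _ _ _ nu nu0 nu_ge0 nu_sigma_additive.

End DensityMeasure.

(** Gives a name to the measure structure of a push-forward, which depends on a
    proof of measurability that inference cannot supply. *)
Definition image_measure d d' (T : measurableType d) (T' : measurableType d')
    (R : realType) (m : {measure set T -> \bar R}) (phi : T -> T')
    (mphi : measurable_fun setT phi) : {measure set T' -> \bar R} :=
  measure_function_pushforward__canonical__measure_function_Measure m mphi.

Section IntegralDensity.
Context d (T : measurableType d) (R : realType).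
Variables (mu M : {measure set T -> \bar R}) (w : T -> R).
Hypotheses (mw : measurable_fun setT w) (w0 : forall x, 0 <= w x).
Hypothesis ME : forall A, measurable A -> M A = (\int[mu]_(x in A) (w x)%:E)%E.
Local Open Scope ereal_scope.

Import HBNNSimple.

Let mwE D : measurable_fun D (EFin \o w).
Proof. by apply: measurable_funTS; exact/measurable_EFinP. Qed.

Let integral_scaled_indic D A (r : R) : measurable D -> measurable A -> (0 <= r)%R ->
  \int[M]_(x in D) (r * \1_A x)%:E = \int[mu]_(x in D) ((r * \1_A x)%:E * (w x)%:E).
Proof.
move=> mD mA r0.
under eq_integral do rewrite EFinM.
rewrite ge0_integralZl//; last first.
  exact/measurable_EFinP/measurable_funTS/measurable_indic.
under [RHS]eq_integral do rewrite EFinM -muleA.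
rewrite [RHS]ge0_integralZl//; last 2 first.
- apply: emeasurable_funM; last exact: mwE.
  by apply/measurable_EFinP.
- by move=> x _; rewrite mule_ge0 ?lee_fin.
congr (_ * _); rewrite integral_indic// ME; last exact: measurableI.
rewrite setIC integral_mkcondr; apply: eq_integral => x _.
by rewrite patchE indicE; case: ifP; rewrite ?mul1e ?mul0e.
Qed.

Lemma integral_density D (f : T -> \bar R) : measurable D ->
  measurable_fun D f -> (forall x, D x -> 0 <= f x) ->
  \int[M]_(x in D) f x = \int[mu]_(x in D) (f x * (w x)%:E).
Proof.
move=> mD mf f0; pose h := nnsfun_approx mD mf.
have hf x : D x -> (h n x)%:E @[n --> \oo] --> f x.
  by move=> Dx; exact: cvg_nnsfun_approx.
have mh n : measurable_fun D (fun x => (h n x)%:E).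
  by apply/measurable_EFinP/measurable_funTS.
have ndh x a b : (a <= b)%N -> (h a x)%:E <= (h b x)%:E.
  by move=> ab; rewrite lee_fin; exact/lefP/nd_nnsfun_approx.
transitivity (limn (fun n => \int[M]_(x in D) (h n x)%:E)).
  rewrite -monotone_convergence//=.
  - by apply: eq_integral => x /[!inE] xD; apply/esym/cvg_lim => //; exact: hf.
  - by move=> n x _; rewrite lee_fin.
  - by move=> x _ a b; exact: ndh.
transitivity (limn (fun n => \int[mu]_(x in D) ((h n x)%:E * (w x)%:E))); last first.
  rewrite -monotone_convergence//=.
  - apply: eq_integral => x /[!inE] xD; apply/cvg_lim => //.
    by apply: cvgeZr => //; exact: hf.
  - by move=> n; apply: emeasurable_funM => //; exact: mwE.
  - by move=> n x _; rewrite mule_ge0 ?lee_fin.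
  - by move=> x _ a b ab; apply: lee_wpmul2r; [rewrite lee_fin|exact: ndh].
congr (limn _); apply/funext => n.
under eq_integral do rewrite fimfunE -fsumEFin//.
rewrite ge0_integral_fsum//; last 2 first.
  - move=> r; apply/measurable_EFinP; apply: measurable_funM => //.
  - by move=> r x _; rewrite EFinM nnfun_muleindic_ge0.
under [RHS]eq_integral.
  move=> x xD; rewrite fimfunE -fsumEFin// ge0_mule_fsuml; last first.
    by move=> r; rewrite EFinM nnfun_muleindic_ge0.
  over.
rewrite [RHS]ge0_integral_fsum//; last 2 first.
- move=> r; apply: emeasurable_funM; last exact: mwE.
  by apply/measurable_EFinP; apply: measurable_funM => //.
- by move=> r x _; apply: mule_ge0; [rewrite EFinM nnfun_muleindic_ge0|rewrite lee_fin].
apply: eq_fsbigr => r; rewrite inE => -[x _ <-].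
by apply: integral_scaled_indic => //; exact: fun_ge0.
Qed.

End IntegralDensity.

(** * The substitution between power densities and Lebesgue measure *)

Lemma measure_eq_left_rays (R : realType) (m1 m2 : {measure set (measurableTypeR R) -> \bar R}) :
  (forall b : R, m1 (`]-oo, b[%classic : set R) = m2 (`]-oo, b[%classic : set R)) ->
  (forall b : R, (m1 (`]-oo, b[%classic : set R) < +oo)%E) ->
  forall A, measurable A -> m1 A = m2 A.
Proof.
move=> m12 m1y A.
apply: (@measure_unique _ R (measurableTypeR R) (@RGenInftyO.G R)
  (fun n => (`]-oo, n%:R[%classic : set R))).
- exact: RGenInftyO.measurableE.
- move=> _ _ [x ->] [y ->]; exists (Num.min x y).
  apply/seteqP; split => z /=; rewrite !in_itv/= lt_min.
    by move=> [-> ->].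
  by move=> /andP[-> ->].
- by move=> n; exists n%:R.
- apply/seteqP; split=> // x _.
  exists (Num.truncn `|x|).+1 => //=; rewrite in_itv/=.
  by rewrite (le_lt_trans (ler_norm _))// truncnS_gt.
- by move=> _ [x ->].
- by move=> n; exact: m1y.
Qed.

Section PowerSubstitution.
Context {R : realType}.
Local Notation leb := (@lebesgue_measure R).
Local Notation pos := (`]0, +oo[%classic : set R).
Variables (a c : R).
Hypotheses (a0 : 0 < a) (c0 : 0 < c).

Let w1 : measurableTypeR R -> R := \1_pos.
Let w2 (x : measurableTypeR R) : R := c `^ (- a) * (a * x `^ (- a - 1)) * \1_pos x.

Let mw1 : measurable_fun setT w1.
Proof. exact: measurable_indic. Qed.

Let w1_ge0 x : 0 <= w1 x. Proof. by []. Qed.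

Let mw2 : measurable_fun setT w2.
Proof.
apply: measurable_funM; last exact: measurable_indic.
by apply: measurable_funM => //; exact: measurable_funM.
Qed.

Let w2_ge0 x : 0 <= w2 x.
Proof. by rewrite /w2 !mulr_ge0 ?powR_ge0// ltW. Qed.

Let psi (x : measurableTypeR R) : measurableTypeR R := (c * x) `^ (- a).

Let mpsi : measurable_fun setT psi.
Proof.
apply: (measurableT_comp (measurable_powR (- a))).
exact: measurable_funM.
Qed.

Let m1 : {measure set (measurableTypeR R) -> \bar R} := density_measure leb mw1 w1_ge0.
Let m2 : {measure set (measurableTypeR R) -> \bar R} :=
  image_measure (density_measure leb mw2 w2_ge0) mpsi.

Let m1_ray (b : R) : m1 (`]-oo, b[%classic : set R) = (Num.max b 0)%:E.
Proof.
rewrite /m1/= /density_measure integral_indic//.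
rewrite (_ : _ `&` _ = `]0, b[%classic); last first.
  apply/seteqP; split=> x /=; rewrite !in_itv/= ?andbT.
    by move=> [-> ->].
  by move=> /andP[-> ->].
transitivity (leb `]0, b[%classic) => //.
rewrite lebesgue_measure_itv/= lte_fin.
by case: ltP => b0 //; rewrite -EFinB subr0.
Qed.

Let m2_ray (b : R) : m2 (`]-oo, b[%classic : set R) = (Num.max b 0)%:E.
Proof.
rewrite /m2/= /pushforward /density_measure.
have [b0|b0] := ltP 0 b; last first.
  rewrite (_ : _ @^-1` _ = set0) ?integral_set0//.
  apply/seteqP; split => // x /=; rewrite in_itv/= => xb.
  by have := lt_le_trans xb b0; rewrite ltNge powR_ge0.
pose d := b `^ (- a^-1) / c.
have d0 : 0 < d by rewrite divr_gt0// powR_gt0.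
transitivity (\int[leb]_(x in `]d, +oo[) ((c `^ (- a))%:E * (a * x `^ (- a - 1))%:E))%E.
  rewrite integral_mkcond [RHS]integral_mkcond; apply: eq_integral => x _.
  rewrite !patchE /w2 indicE.
  have [x0|x0] := ltP 0 x.
    rewrite (mem_set (_ : pos x)) ?mulr1/= ?in_itv/= ?x0//.
    congr (if _ then _ else _); apply/idP/idP; rewrite !inE/= !in_itv/= andbT;
      by rewrite /psi powRN_lt ?mulr_gt0// /d ltr_pdivrMr// mulrC.
  rewrite (memNset (_ : ~ pos x)) ?mulr0; last first.
    by rewrite /= in_itv/= andbT; apply/negP; rewrite -leNgt.
  rewrite (memNset (_ : ~ `]d, +oo[%classic x)) ?if_same//=.
  by rewrite in_itv/= andbT; apply/negP; rewrite -leNgt (le_trans x0)// ltW.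
rewrite ge0_integralZl//=; last 3 first.
- apply/measurable_EFinP/measurable_funTS; apply: measurable_funM => //.
- by move=> x _; rewrite lee_fin mulr_ge0 ?powR_ge0// ltW.
- by rewrite lee_fin powR_ge0.
rewrite integral_powRN_tail// -EFinM; congr EFin.
rewrite -powRM ?(ltW c0) ?(ltW d0)// mulrC divfK ?gt_eqF// powRNKV//.
Qed.

Let m12 A : measurable A -> m1 A = m2 A.
Proof.
apply: measure_eq_left_rays => b; first by rewrite m2_ray -m1_ray.
by rewrite [X in (X < _)%E]m1_ray ltry.
Qed.

(** The map [x |-> (c * x) `^ (- a)] carries the measure with density
    proportional to [x `^ (- a - 1)] to Lebesgue measure on the half line, as a
    comparison of the two measures on the left rays shows. *)
Lemma integral_power_subst (f : R -> \bar R) : measurable_fun pos f ->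
  (forall x, 0 < x -> (0 <= f x)%E) ->
  (\int[leb]_(v in pos) f (v `^ (- a^-1) / c)%R =
   (c `^ (- a))%:E * \int[leb]_(x in pos) (f x * (a * x `^ (- a - 1))%:E))%E.
Proof.
move=> mf f0.
have phi0 v : pos v -> 0 < v `^ (- a^-1) / c.
  by rewrite /= in_itv/= andbT => v0; rewrite divr_gt0// powR_gt0.
have mphi : measurable_fun pos (fun v => f (v `^ (- a^-1) / c)%R).
  apply: (measurable_comp (F := pos)) => //.
    by move=> _ [v v0 <-]; rewrite /= in_itv/= andbT; exact: phi0.
  by apply: measurable_funTS; apply: measurable_funM => //; exact: measurable_powR.
transitivity (\int[m1]_(v in pos) f (v `^ (- a^-1) / c)%R)%E.
  rewrite (@integral_density _ _ _ leb m1 w1 mw1 w1_ge0 (fun _ _ => erefl))//; last first.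
    by move=> v /phi0/f0.
  by apply: eq_integral => v vpos; rewrite /w1 indicE vpos mule1.
rewrite (@eq_measure_integral _ _ _ _ m2); last by move=> A mA _; exact: m12.
rewrite ge0_integral_pushforward//; last first.
  by move=> y; rewrite inE => /phi0/f0.
rewrite (@integral_density _ _ _ leb (density_measure leb mw2 w2_ge0) w2 mw2
  w2_ge0 (fun _ _ => erefl))//; last 3 first.
- rewrite -[X in measurable X]setTI; exact: mpsi.
- apply: (measurable_comp (F := pos)) => //.
    by move=> _ [x + <-].
  by apply: measurable_funTS; exact: mpsi.
- by move=> x /phi0/f0.
rewrite integral_mkcond [X in (_ * X)%E]integral_mkcond.
rewrite -ge0_integralZl//; last 3 first.
- apply/(measurable_restrictT _ _).1 => //.
  apply: emeasurable_funM => //; apply/measurable_EFinP/measurable_funTS.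
  by apply: measurable_funM.
- move=> x _; rewrite patchE; case: ifPn => // /set_mem; rewrite /= in_itv/= andbT => x0.
  by rewrite mule_ge0 ?f0// lee_fin mulr_ge0 ?powR_ge0// ltW.
- by rewrite lee_fin powR_ge0.
apply: eq_integral => x _; rewrite !patchE /w2 indicE.
have [x0|x0] := ltP 0 x; last first.
  rewrite (memNset (_ : ~ pos x)) ?mulr0 ?mule0 ?if_same//.
  by rewrite /= in_itv/= andbT; apply/negP; rewrite -leNgt.
have xpos : pos x by rewrite /= in_itv/= x0.
rewrite (mem_set xpos) mem_set/=; last first.
  by rewrite in_itv/= andbT powR_gt0 ?mulr_gt0.
rewrite mulr1 powRNK ?mulr_gt0// mulrAC divff ?gt_eqF// mul1r.
by rewrite EFinM muleCA.
Qed.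

End PowerSubstitution.

Section HalfLineIntegrals.
Context {R : realType}.
Local Notation leb := (@lebesgue_measure R).
Local Notation pos := (`]0, +oo[%classic : set R).
Implicit Types a c u : R.

(** The substitution applied to the indicator of a null set containing [N]. *)
Lemma negligible_power_subst a c (N : set R) : 0 < a -> 0 < c ->
  leb.-negligible N ->
  leb.-negligible [set v | 0 < v /\ N (v `^ (- a^-1) / c)].
Proof.
move=> a0 c0 [A [mA A0 NA]].
pose phi (v : R) : R := v `^ (- a^-1) / c.
have mphi : measurable_fun setT phi by apply: measurable_funM.
exists (pos `&` phi @^-1` A); split.
- by apply: measurableI => //; rewrite -[X in measurable X]setTI; exact: mphi.
- rewrite setIC -integral_indic//; last first.
    by rewrite -[X in measurable X]setTI; exact: mphi.
  have -> : (fun v => (\1_(phi @^-1` A) v)%:E) =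
      (fun v => ((\1_A : R -> R) (v `^ (- a^-1) / c)%R)%:E) by [].
  rewrite (integral_power_subst a0 c0 (f := fun x => (\1_A x)%:E))//; last first.
    by apply/measurable_EFinP; exact: measurable_indic.
  rewrite (_ : (\int[leb]_(x in pos) _)%E = 0%E) ?mule0//.
  under eq_integral do rewrite muleC.
  rewrite (eq_integral (fun x => ((fun x => (a * x `^ (- a - 1))%:E) \_ A) x)).
    rewrite -integral_mkcondr; apply: null_set_integral.
    - exact: measurableI.
    - by apply/measurable_EFinP/measurable_funTS; exact: measurable_funM.
    - by apply: (subset_measure0 _ mA _ A0) => //; exact: measurableI.
  move=> x _; rewrite patchE indicE; case: ifPn => xA; first by rewrite mule1.
  by rewrite mule0.
- by move=> v [v0 Nv]; split; [rewrite /= in_itv/= v0|exact: NA].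
Qed.

Lemma integral_expRN (y : R) : 0 < y ->
  (\int[leb]_(s in `]0%R, y[) (expR (- s))%:E = (1 - expR (- y))%:E)%E.
Proof.
move=> y0.
have cexp : continuous (fun s : R => expR (- s)).
  by move=> s; apply: continuous_comp; [exact: opp_continuous|exact: continuous_expR].
rewrite integral_itv_obnd_cbnd ?integral_itv_bndo_bndc//.
rewrite (@continuous_FTC2 _ _ (fun s => - expR (- s)))//.
- by rewrite -EFinB; congr EFin; rewrite oppr0 expR0 opprK addrC.
- exact: continuous_subspaceT.
- split.
  + by move=> s _; exact: ex_derive.
  + by apply: cvg_at_right_filter; apply: cvgN; exact: cexp.
  + by apply: cvg_at_left_filter; apply: cvgN; exact: cexp.
- move=> s _; rewrite derive1E; apply: derive_val.
  by apply: is_derive_eq; rewrite mulrN1 opprK.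
- by apply/measurable_EFinP/measurable_funTS; exact: continuous_measurable_fun.
- by apply/measurable_EFinP/measurable_funTS; exact: continuous_measurable_fun.
Qed.

(** Writing [1 - expR (- y)] as the integral of [expR (- s)] over [0 < s < y]
    and exchanging the integrals turns the Laplace exponent of the stable law
    into the Gamma integral. *)
Lemma stable_exponent a u : 0 < a -> 0 < u ->
  \int[leb]_(v in pos) (1 - expR (- (u * v `^ (- a^-1)))) =
  u `^ a * Gamma_fun (1 - a).
Proof.
move=> a0 u0.
pose A := [set z : measurableTypeR R * measurableTypeR R |
  [/\ 0 < z.1, 0 < z.2 & z.2 < u * z.1 `^ (- a^-1)]].
have mA : measurable A.
  have -> : A = [set z | 0 < z.1] `&` ([set z | 0 < z.2] `&`
      [set z | z.2 < u * z.1 `^ (- a^-1)]).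
    by apply/seteqP; split=> z /=; [case|case=> ? []].
  have lt (g h : measurableTypeR R * measurableTypeR R -> R) :
      measurable_fun setT g -> measurable_fun setT h ->
      measurable [set z | g z < h z].
    move=> mg mh; have := measurable_fun_ltr mg mh measurableT.
    by move=> /(_ [set true]); rewrite setTI; exact.
  apply: measurableI; last apply: measurableI; apply: lt => //.
  apply: measurable_funM => //.
  exact: (measurableT_comp (measurable_powR _)).
pose f (z : measurableTypeR R * measurableTypeR R) : \bar R :=
  (expR (- z.2) * \1_A z)%:E.
have mf : measurable_fun setT f.
  apply/measurable_EFinP/measurable_funM; last exact: measurable_indic.
  do 2 apply: measurableT_comp => //.
have f0 z : (0 <= f z)%E by rewrite lee_fin mulr_ge0 ?expR_ge0.
have := @fubini_tonelli _ _ _ _ R leb leb f mf f0.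
have -> : (\int[leb]_v \int[leb]_s f (v, s) =
    \int[leb]_(v in pos) (1 - expR (- (u * v `^ (- a^-1))))%:E)%E.
  rewrite [RHS]integral_mkcond; apply: eq_integral => v _.
  rewrite patchE; case: ifPn => [/set_mem|/negP] vpos.
    move: (vpos); rewrite /= in_itv/= andbT => v0.
    rewrite -integral_expRN ?mulr_gt0 ?powR_gt0//.
    rewrite [RHS]integral_mkcond; apply: eq_integral => s _.
    rewrite patchE /f indicE; case: ifPn => [/set_mem|/negP] sI.
      rewrite mem_set ?mulr1//.
      by move: sI; rewrite /= in_itv/= => /andP[? ?].
    rewrite memNset ?mulr0// => -[_ s0 sv]; apply: sI; rewrite inE/=.
    by rewrite in_itv/= s0.
  rewrite integral0_eq// => s _; rewrite /f indicE memNset ?mulr0//.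
  by move=> [v0 _ _]; apply: vpos; rewrite inE/= in_itv/= v0.
have -> : (\int[leb]_s \int[leb]_v f (v, s) =
    (u `^ a)%:E * \int[leb]_(s in pos) (s `^ ((1 - a) - 1) * expR (- s))%:E)%E.
  rewrite -ge0_integralZl//; last 3 first.
  - apply/measurable_EFinP/measurable_funTS/measurable_funM => //.
    exact: measurableT_comp.
  - by move=> s _; rewrite lee_fin mulr_ge0 ?powR_ge0 ?expR_ge0.
  - by rewrite lee_fin powR_ge0.
  rewrite [RHS]integral_mkcond; apply: eq_integral => s _.
  rewrite patchE; case: ifPn => [/set_mem|/negP] spos; last first.
    rewrite integral0_eq// => v _; rewrite /f indicE memNset ?mulr0//.
    by move=> [_ s0 _]; apply: spos; rewrite inE/= in_itv/= s0.
  move: (spos); rewrite /= in_itv/= andbT => s0.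
  transitivity (\int[leb]_(v in `]0%R, ((s / u) `^ (- a))%R[) (expR (- s))%:E)%E.
    rewrite [RHS]integral_mkcond; apply: eq_integral => v _.
    rewrite patchE /f indicE; case: ifPn => [/set_mem|/negP] vI.
      rewrite mem_set ?mulr1//; move: vI; rewrite /= in_itv/= => /andP[v0 vs].
      by split=> //=; rewrite -ltr_pdivrMl// mulrC -powRN_gt// divr_gt0.
    rewrite memNset ?mulr0// => -[/= v0 _ sv]; apply: vI; rewrite inE/= in_itv/= v0/=.
    by rewrite powRN_gt ?divr_gt0// mulrC ltr_pdivrMl.
  rewrite integral_cst//.
  rewrite [X in (_ * X)%E](_ : _ = ((s / u) `^ (- a))%:E).
    rewrite -!EFinM; congr EFin.
    rewrite powRM ?invr_ge0 ?(ltW s0) ?(ltW u0)//.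
    rewrite -[u^-1]powR_inv1 ?(ltW u0)// -powRrM mulN1r opprK.
    by rewrite (_ : 1 - a - 1 = - a); [ring|ring].
  transitivity (leb (`]0, (s / u) `^ (- a)[%classic : set R)) => //.
  rewrite lebesgue_measure_itv/= lte_fin powR_gt0 ?divr_gt0//.
  by rewrite -EFinB subr0.
rewrite /Rintegral /Gamma_fun => ->.
have : 0 < u `^ a by rewrite powR_gt0.
rewrite /Rintegral; case: (\int[leb]_(x in _) _)%E => [r||] //= ua.
  by rewrite gt0_muley ?lte_fin//= mulr0.
by rewrite gt0_muleNy ?lte_fin//= mulr0.
Qed.

End HalfLineIntegrals.

(** * Regularly varying tails and their quantiles *)

Section RegularVariation.
Context {R : realType}.
Variables (mu : probability nat R) (alpha : R) (L : R -> R).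
Hypotheses (alpha0 : 0 < alpha) (alpha1 : alpha < 1).
Hypothesis mu_tail : forall t : R, 0 < t ->
  mu [set k : nat | t < k%:R] = (t `^ (- alpha) * L t)%:E.
Hypothesis slowL : slowly_varying L.

Definition tail (mu : probability nat R) (t : R) : R :=
  fine (mu [set k : nat | t < k%:R]).

Local Notation F := (tail mu).

Lemma tailE t : (F t)%:E = mu [set k : nat | t < k%:R].
Proof. by rewrite fineK// fin_num_measure. Qed.

Lemma tail_ge0 t : 0 <= F t.
Proof. by rewrite fine_ge0. Qed.

Lemma tail_le1 t : F t <= 1.
Proof. by rewrite -lee_fin tailE probability_le1. Qed.

Lemma tail_nonincreasing s t : s <= t -> F t <= F s.
Proof.
move=> st; rewrite -lee_fin !tailE le_measure ?inE//.
by move=> k /=; exact: le_lt_trans.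
Qed.

Let F_L t : 0 < t -> F t = t `^ (- alpha) * L t.
Proof. by move=> t0; rewrite /tail mu_tail. Qed.

Lemma tail_regularly_varying (x : R) : 0 < x ->
  F (x * t) / F t @[t --> +oo] --> x `^ (- alpha).
Proof.
move=> x0; rewrite -[X in _ --> X]mulr1 -[X in _ * X](powRr0 x).
have : x `^ (- alpha) * (L (x * t) / L t) @[t --> +oo] -->
    x `^ (- alpha) * x `^ 0 by apply: cvgMr; exact: slowL.
apply: cvg_trans; apply: near_eq_cvg; near=> t.
have t0 : 0 < t by near: t; exact: nbhs_pinfty_gt.
rewrite !F_L ?mulr_gt0// powRM ?(ltW x0) ?(ltW t0)//.
have : t `^ (- alpha) != 0 by rewrite gt_eqF// powR_gt0.
move=> tn0; have [->|L0] := eqVneq (L t) 0; first by rewrite !mulr0 invr0 !mulr0.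
by field; rewrite tn0 L0.
Unshelve. all: by end_near. Qed.

(** A zero of [F] would be a zero of all later values, which the convergence of
    [F (1 * t) / F t] to 1 excludes. *)
Lemma tail_gt0 t : 0 < F t.
Proof.
have h := tail_regularly_varying ltr01.
have h1 : 0 < (1 : R) `^ (- alpha) by rewrite powR1.
have /(_ t)[s [ts Fs]] : forall t, exists s, t <= s /\ 0 < F s.
  move=> {}t.
  have [M [Mr HM]] : \forall s \near +oo, 0 < F (1 * s) / F s.
    move/cvgrPdist_lt : h => /(_ _ h1); apply: filterS => s.
    by rewrite ltr_distlC => /andP[]; rewrite subrr.
  exists (Num.max t (M + 1)); split; first by rewrite le_max lexx.
  rewrite lt_neqAle tail_ge0 andbT eq_sym; apply/eqP => F0.
  have /HM : M < Num.max t (M + 1) by rewrite lt_max ltrDl ltr01 orbT.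
  by rewrite F0 invr0 mulr0 ltxx.
exact: lt_le_trans Fs (tail_nonincreasing ts).
Qed.

Lemma tail_cvg0 : F t @[t --> +oo] --> 0.
Proof.
have Fn : F n%:R @[n --> \oo] --> 0.
  apply: (fine_cvg (a := 0) (f := fun n => mu [set k : nat | n%:R < k%:R])).
  have <- : mu (\bigcap_n [set k : nat | (n%:R : R) < k%:R]) = 0%:E.
    rewrite (_ : \bigcap_n _ = set0) ?measure0//.
    by apply/seteqP; split=> // k /(_ k I)/=; rewrite ltxx.
  apply: nonincreasing_cvg_mu => //.
  - by rewrite (le_lt_trans (probability_le1 mu _))// ltry.
  - move=> i j ij; apply/subsetPset => k /=; apply: le_lt_trans.
    by rewrite ler_nat.
apply/cvgrPdist_lt => e e0.
move/cvgrPdist_lt : Fn => /(_ _ e0)[N _ /(_ N (leqnn N))/=].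
rewrite sub0r normrN ger0_norm ?tail_ge0// => FN.
near=> t.
rewrite sub0r normrN ger0_norm ?tail_ge0//.
apply: le_lt_trans FN; apply: tail_nonincreasing.
by near: t; exact: nbhs_pinfty_ge.
Unshelve. all: by end_near. Qed.

Local Notation V := (fun t : R => t `^ alpha / L t).
Local Notation b := (fun n : nat => gen_inverse V n%:R).

Lemma V_tail t : 0 < t -> t `^ alpha / L t = (F t)^-1.
Proof. by move=> t0; rewrite F_L// invfM -powRN opprK. Qed.

Let Vset_has_inf n : has_inf [set s : R | 0 < s /\ n%:R < s `^ alpha / L s].
Proof.
split; last by exists 0 => s [/ltW].
have n1 : 0 < n.+1%:R^-1 :> R by rewrite invr_gt0 ltr0n.
move/cvgrPdist_lt : tail_cvg0 => /(_ _ n1) [M [Mr HM]].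
exists (Num.max 1 (M + 1)) => /=; split; first by rewrite lt_max ltr01.
rewrite V_tail ?lt_max ?ltr01//.
have /HM/= : M < Num.max 1 (M + 1) by rewrite lt_max ltrDl ltr01 orbT.
rewrite sub0r normrN ger0_norm ?tail_ge0// => h.
apply: (@lt_trans _ _ n.+1%:R); first by rewrite ltr_nat.
by rewrite -[ltLHS]invrK ltf_pV2 ?posrE ?tail_gt0.
Qed.

Lemma tail_above_quantile (n : nat) (s : R) : b n < s -> n%:R * F s < 1.
Proof.
move=> /inf_lt [|t [t0]] /=; first by have [] := Vset_has_inf n.
rewrite V_tail// => nt ts.
rewrite -ltr_pdivlMr ?tail_gt0// div1r (lt_le_trans nt)//.
by rewrite lef_pV2 ?posrE ?tail_gt0// tail_nonincreasing// ltW.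
Qed.

Lemma tail_below_quantile (n : nat) (s : R) : 0 < s -> s < b n -> 1 <= n%:R * F s.
Proof.
move=> s0 sb; rewrite leNgt -ltr_pdivlMr ?tail_gt0// div1r -V_tail//.
apply/negP => ns; have := sb; rewrite ltNge => /negP; apply.
by apply: ge_inf => //; have [] := Vset_has_inf n.
Qed.

Lemma quantile_cvg_pinfty : b n @[n --> \oo] --> +oo.
Proof.
apply/cvgryPge => A; near=> n.
apply: lb_le_inf; first by have [] := Vset_has_inf n.
move=> s [s0] /=; rewrite V_tail// => ns; rewrite leNgt; apply/negP => sA.
have : n%:R < (F A)^-1.
  by rewrite (lt_le_trans ns)// lef_pV2 ?posrE ?tail_gt0// tail_nonincreasing// ltW.
by rewrite ltNge => /negP; apply; near: n; exact: nbhs_infty_ger.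
Unshelve. all: by end_near. Qed.

(** The definition of [b n] only says that [n%:R * F s] crosses 1 at [b n];
    comparing with the slightly larger or smaller multiples of [b n] by regular
    variation locates [n%:R * F (b n * x)]. *)
Lemma tail_scaled_lt (x v : R) : 0 < v -> v `^ (- alpha^-1) < x ->
  \forall n \near \oo, n%:R * F (x * b n) < v.
Proof.
move=> v0 vx; have p0 : 0 < v `^ (- alpha^-1) by rewrite powR_gt0.
pose y := (v `^ (- alpha^-1) + x) / 2.
have yx : y < x by rewrite /y midf_lt.
have vy : v `^ (- alpha^-1) < y by rewrite /y midf_lt.
have y0 : 0 < y := lt_trans p0 vy.
have yv : y `^ (- alpha) < v by rewrite powRN_lt.
have x0 := lt_trans y0 yx.
pose l := x / y; have l1 : 1 < l by rewrite ltr_pdivlMr// mul1r.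
have l0 : 0 < l by rewrite divr_gt0.
have H : \forall t \near +oo, F (y * t) / F t < v.
  have /cvgrPdist_lt := tail_regularly_varying y0.
  have d0 : 0 < v - y `^ (- alpha) by rewrite subr_gt0.
  move=> /(_ _ d0); apply: filterS => t; rewrite ltr_distlC => /andP[_].
  by rewrite addrC subrK.
have bl : l * b n @[n --> \oo] --> +oo.
  exact: (@gt0_cvgMry _ (b n @[n --> \oo]) _ _ id l0 quantile_cvg_pinfty).
have {H}H := bl _ H; near=> n.
have b0 : 0 < b n by near: n; move/cvgryPgt : quantile_cvg_pinfty; apply.
have Hn' : F (x * b n) < v * F (l * b n).
  rewrite -ltr_pdivrMr ?tail_gt0//.
  rewrite (_ : x * b n = y * (l * b n)); first by near: n; exact: H.
  by rewrite /l mulrA mulrCA divff ?mulr1// gt_eqF.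
have n0 : 0 < n%:R :> R by near: n; exact: nbhs_infty_gtr.
apply: (@lt_le_trans _ _ (v * (n%:R * F (l * b n)))).
  by rewrite mulrCA ltr_pM2l.
rewrite ger_pMr//; apply: ltW; apply: tail_above_quantile.
by rewrite ltr_pMl.
Unshelve. all: by end_near. Qed.

Lemma tail_scaled_gt (x v : R) : 0 < v -> 0 < x -> x < v `^ (- alpha^-1) ->
  \forall n \near \oo, v < n%:R * F (x * b n).
Proof.
move=> v0 x0 xv; pose y := (x + v `^ (- alpha^-1)) / 2.
have xy : x < y by rewrite /y midf_lt.
have yv : y < v `^ (- alpha^-1) by rewrite /y midf_lt.
have y0 : 0 < y := lt_trans x0 xy.
have vy : v < y `^ (- alpha) by rewrite powRN_gt.
pose l := x / y; have l1 : l < 1 by rewrite ltr_pdivrMr// mul1r.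
have l0 : 0 < l by rewrite divr_gt0.
have H : \forall t \near +oo, v < F (y * t) / F t.
  have /cvgrPdist_lt := tail_regularly_varying y0.
  have d0 : 0 < y `^ (- alpha) - v by rewrite subr_gt0.
  move=> /(_ _ d0); apply: filterS => t; rewrite ltr_distlC => /andP[+ _].
  by rewrite opprB addrC subrK.
have bl : l * b n @[n --> \oo] --> +oo.
  exact: (@gt0_cvgMry _ (b n @[n --> \oo]) _ _ id l0 quantile_cvg_pinfty).
have {H}H := bl _ H; near=> n.
have b0 : 0 < b n by near: n; move/cvgryPgt : quantile_cvg_pinfty; apply.
have Hn' : v * F (l * b n) < F (x * b n).
  rewrite -ltr_pdivlMr ?tail_gt0//.
  rewrite (_ : x * b n = y * (l * b n)); first by near: n; exact: H.
  by rewrite /l mulrA mulrCA divff ?mulr1// gt_eqF.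
have n0 : 0 < n%:R :> R by near: n; exact: nbhs_infty_gtr.
apply: (@le_lt_trans _ _ (v * (n%:R * F (l * b n)))); last first.
  by rewrite mulrCA ltr_pM2l.
rewrite ler_pMr//; apply: tail_below_quantile; first by rewrite mulr_gt0.
by rewrite gtr_pMl.
Unshelve. all: by end_near. Qed.

(** A weak Potter bound.  Halving the argument multiplies the tail by
    asymptotically [2 `^ alpha], hence eventually by at most [2 `^ beta]; this is
    iterated along [y, 2 y, 4 y, ...] up to the reference point [2 t]. *)
Lemma tail_potter (beta : R) : alpha < beta -> exists2 t0 : R, 0 < t0 &
  forall t y : R, t0 <= t -> 0 < y -> y <= 2 -> t0 <= y * t ->
    F (y * t) <= 4 `^ beta * y `^ (- beta) * F (2 * t).
Proof.
move=> ab; have b0 : 0 < beta := lt_trans alpha0 ab.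
have [t1 t10 dbl] : exists2 t1 : R, 0 < t1 & forall s, t1 <= s ->
    F s <= 2 `^ beta * F (2 * s).
  (* one halving step, valid beyond some [t1] *)
  have h2 : 0 < (2^-1 : R) by rewrite invr_gt0.
  have /cvgrPdist_lt h := tail_regularly_varying h2.
  have d0 : 0 < 2 `^ beta - 2^-1 `^ (- alpha).
    rewrite subr_gt0 -(powR_inv1 (ler0n _ _)) -powRrM mulrNN mul1r.
    by rewrite /powR pnatr_eq0/= ltr_expR ltr_pM2r// ln_gt0// ltr1n.
  have [M [Mr HM]] := h _ d0.
  exists (Num.max 1 (M + 1)); first by rewrite lt_max ltr01.
  move=> s; rewrite ge_max => /andP[s1 Ms].
  have : M < 2 * s.
    apply: (@lt_le_trans _ _ s); first by rewrite (lt_le_trans _ Ms)// ltrDl.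
    by rewrite ler_peMl ?ler1n// (le_trans _ s1).
  move=> /HM/=; rewrite mulrA mulVf ?pnatr_eq0// mul1r ltr_distlC => /andP[_].
  by rewrite addrC subrK ltr_pdivrMr ?tail_gt0// => /ltW.
exists t1 => // t y t1t y0 y2 t1y.
(* [j] bounds the number of doublings that bring [y] above 1 *)
have [j yj] : exists j, 2 <= 2 ^+ j * y.
  exists (Num.truncn (2 / y)).+1; rewrite -ler_pdivrMr//.
  apply: (@le_trans _ _ (Num.truncn (2 / y)).+1%:R); first by rewrite ltW// truncnS_gt.
  by rewrite -natrX ler_nat ltnW// ltn_expl.
have four : (4 : R) `^ beta = 2 `^ beta * 2 `^ beta.
  by rewrite -powRM// -natrM.
have base z : 1 <= z -> z <= 2 ->
    F (z * t) <= 4 `^ beta * z `^ (- beta) * F (2 * t).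
  move=> z1 z2; have z0 : 0 < z := lt_le_trans ltr01 z1.
  have tz : t <= z * t by rewrite ler_peMl// ltW// (lt_le_trans t10).
  apply: (le_trans (tail_nonincreasing tz)); apply: (le_trans (dbl _ t1t)).
  rewrite ler_wpM2r ?tail_ge0// four -mulrA ler_peMr ?powR_ge0//.
  rewrite powRN ler_pdivlMr ?powR_gt0// mul1r.
  by apply: ge0_ler_powR => //; rewrite ?nnegrE ltW.
elim: j y y0 y2 t1y yj => [|j IH] y y0 y2 t1y yj.
  by apply: base => //; move: yj; rewrite expr0 mul1r; apply: le_trans; rewrite ler1n.
have [y1|/ltW y1] := leP y 1; last exact: base.
apply: (le_trans (dbl _ t1y)).
have /IH : 0 < 2 * y by rewrite mulr_gt0.
have y22 : 2 * y <= 2 by rewrite ger_pMr.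
have t1y2 : t1 <= 2 * y * t.
  by rewrite (le_trans t1y)// ler_wpM2r ?(le_trans (ltW t10))// ler_peMl ?ler1n// ltW.
have yj2 : 2 <= 2 ^+ j * (2 * y) by rewrite mulrA -exprSr.
move=> /(_ y22 t1y2 yj2).
have b20 : 0 < (2 : R) `^ beta by rewrite powR_gt0.
rewrite -(ler_pM2l b20) [2 * (y * t)]mulrA => /le_trans. apply.
rewrite powRM ?ler0n ?(ltW y0)// [2 `^ (- beta)]powRN.
by rewrite le_eqVlt; apply/orP; left; apply/eqP; field; rewrite gt_eqF.
Qed.

(** The reference value of the Potter bound is [n%:R * F (2 * b n)], which is
    below 1.  Below the threshold [t0] of that bound, [F] is at most 1, that is
    [F t0 / F t0]: this costs the factor [(F t0)^-1] in the constant. *)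
Lemma tail_scaled_bound (beta : R) : alpha < beta -> beta < 1 ->
  exists2 K : R, 0 < K &
  \forall n \near \oo, forall y, 0 < y -> y <= 2 ->
    n%:R * F (y * b n) <= K * y `^ (- beta).
Proof.
move=> ab b1; have [t0 t00 potter] := tail_potter ab.
have F0 := tail_gt0 t0.
exists (4 / F t0); first by rewrite divr_gt0.
near=> n => y y0 y2.
have bt0 : t0 <= b n by near: n; move/cvgryPge : quantile_cvg_pinfty; apply.
have b0 : 0 < b n := lt_le_trans t00 bt0.
have n0 : 0 <= n%:R :> R by [].
have main z : 0 < z -> z <= 2 -> t0 <= z * b n ->
    n%:R * F (z * b n) <= 4 * z `^ (- beta).
  move=> z0 z2 tz; apply: (le_trans (ler_wpM2l n0 (potter _ _ bt0 z0 z2 tz))).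
  rewrite mulrCA -[leRHS]mulr1; apply: ler_pM.
  - by rewrite mulr_ge0 ?powR_ge0.
  - by rewrite mulr_ge0 ?tail_ge0.
  - by rewrite ler_wpM2r ?powR_ge0// ler1_powR ?ler1n// ltW.
  - by apply/ltW/tail_above_quantile; rewrite ltr_pMl ?ltr1n.
have [tz|tz] := leP t0 (y * b n).
  apply: (le_trans (main _ y0 y2 tz)).
  rewrite ler_wpM2r ?powR_ge0// ler_pdivlMr// ger_pMr ?tail_le1//.
rewrite mulrAC ler_pdivlMr//.
have z0 : 0 < t0 / b n by rewrite divr_gt0.
have := main (t0 / b n) z0; rewrite divfK ?gt_eqF// lexx => /(_ _ isT) h.
apply: (@le_trans _ _ (n%:R * F t0)).
  by rewrite -mulrA ler_wpM2l// ger_pMl ?tail_le1.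
apply: (le_trans (h _)).
  by rewrite ler_pdivrMr// (le_trans bt0)// ler_peMl ?ler1n// ltW.
rewrite ler_wpM2l//; apply/ltW/ltr_powRN => //; first exact: lt_trans ab.
by rewrite ltr_pdivlMr.
Unshelve. all: by end_near. Qed.

(** [tail_quantile mu N] pushes Lebesgue measure on the half line forward to
    [N] times [mu] on the positive integers: it is the generalized inverse of
    the nonincreasing function [N * F]. *)
Definition tail_quantile (mu : probability nat R) (N v : R) : nat :=
  if pselect (exists k : nat, N * tail mu k%:R < v) is left h
  then ex_minn h else 0%N.

Local Notation Q := (tail_quantile mu).

Lemma tail_trunc t : 0 <= t -> F (Num.truncn t)%:R = F t.
Proof.
move=> t0; congr (fine (mu _)); apply/funext => k.
by rewrite /mkset/= ltr_nat truncn_lt_nat.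
Qed.

(** The Galois connection through which all properties of the quantile are
    read off the tail. *)
Lemma tail_quantile_le (N v t : R) : 0 <= N -> 0 < v -> 0 <= t ->
  (((Q N v)%:R <= t) = (N * F t < v)).
Proof.
move=> N0 v0 t0; rewrite /tail_quantile; case: pselect => [h|]; last first.
  case.
  have [N00|N1] := leP N 0.
    by exists 0%N; rewrite (le_lt_trans _ v0)// mulr_le0_ge0 ?tail_ge0.
  have vN : 0 < v / N by rewrite divr_gt0.
  move/cvgrPdist_lt : tail_cvg0 => /(_ _ vN) [M [Mr HM]].
  exists (Num.truncn `|M|).+1.
  have /HM/= : M < (Num.truncn `|M|).+1%:R.
    by rewrite (le_lt_trans (ler_norm _))// truncnS_gt.
  by rewrite sub0r normrN ger0_norm ?tail_ge0// ltr_pdivlMr// mulrC.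
case: ex_minnP => k kv kmin; apply/idP/idP => [kt|].
  by apply: le_lt_trans kv; rewrite ler_wpM2l// tail_nonincreasing.
rewrite -(tail_trunc t0) => /kmin kt.
by apply: (@le_trans _ _ (Num.truncn t)%:R); rewrite ?ler_nat// truncn_le.
Qed.

Lemma tail_quantile_cvg (v : R) : 0 < v ->
  (Q n%:R v)%:R / b n @[n --> \oo] --> v `^ (- alpha^-1).
Proof.
move=> v0; have p0 : 0 < v `^ (- alpha^-1) by rewrite powR_gt0.
apply/cvgrPdist_le => e e0.
pose x1 := v `^ (- alpha^-1) + e.
pose x2 := Num.max (v `^ (- alpha^-1) / 2) (v `^ (- alpha^-1) - e).
have x20 : 0 < x2 by rewrite lt_max divr_gt0.
have x2v : x2 < v `^ (- alpha^-1).
  by rewrite gt_max ltr_pdivrMr// ltr_pMr// ltr1n ltrBlDr ltrDl.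
have x1v : v `^ (- alpha^-1) < x1 by rewrite ltrDl.
near=> n.
have b0 : 0 < b n by near: n; move/cvgryPgt : quantile_cvg_pinfty; apply.
have n0 : 0 <= n%:R :> R by [].
rewrite ler_distlC; apply/andP; split; last first.
  rewrite ler_pdivrMr// tail_quantile_le//; last by rewrite mulr_ge0 ?ltW// (lt_trans p0).
  by near: n; exact: tail_scaled_lt.
apply: (@le_trans _ _ x2); first by rewrite le_max lexx orbT.
rewrite ler_pdivlMr// leNgt; apply/negP => /ltW.
rewrite tail_quantile_le// ?mulr_ge0// ?ltW//; apply/negP; rewrite -leNgt.
by apply/ltW; near: n; exact: tail_scaled_gt.
Unshelve. all: by end_near. Qed.

Lemma tail_quantile_dom (beta : R) : alpha < beta -> beta < 1 ->
  exists2 K : R, 0 < K & \forall n \near \oo, forall v, K <= v ->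
    (Q n%:R v)%:R / b n <= (v / K) `^ (- beta^-1).
Proof.
move=> ab b1; have [K0 K00 HK] := tail_scaled_bound ab b1.
have beta0 : 0 < beta := lt_trans alpha0 ab.
(* the factor 2 turns the bound of [tail_scaled_bound] into a strict one, as
   the Galois connection requires *)
exists (2 * K0); first by rewrite mulr_gt0.
near=> n => v Kv.
have K20 : 0 < 2 * K0 by rewrite mulr_gt0.
have v0 : 0 < v := lt_le_trans K20 Kv.
have b0 : 0 < b n by near: n; move/cvgryPgt : quantile_cvg_pinfty; apply.
have vK1 : 1 <= v / (2 * K0) by rewrite ler_pdivlMr// mul1r.
have vK0 : 0 < v / (2 * K0) := lt_le_trans ltr01 vK1.
set y := (v / (2 * K0)) `^ _.
have y0 : 0 < y by rewrite powR_gt0.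
have y2 : y <= 2.
  apply: (@le_trans _ _ 1); last by rewrite ler1n.
  rewrite /y powRN invf_le1 ?powR_gt0// -[X in X <= _](powRr0 (v / (2 * K0))).
  by rewrite ler_powR// invr_ge0 ltW.
rewrite ler_pdivrMr// tail_quantile_le ?mulr_ge0 ?ler0n ?(ltW y0) ?(ltW b0)//.
apply: (@le_lt_trans _ _ (K0 * y `^ (- beta))).
  by move: y y0 y2; near: n.
rewrite powRNKV// invfM mulrCA.
rewrite (_ : _ * _ = v / 2); first by rewrite ltr_pdivrMr// ltr_pMr// ltr1n.
by field; rewrite gt_eqF.
Unshelve. all: by end_near. Qed.

Local Notation leb := (@lebesgue_measure R).
Local Notation pos := (`]0, +oo[%classic : set R).

(** The level sets of the quantile. *)
Let band (N : R) (k : nat) : set R :=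
  if k is j.+1 then `]N * F j.+1%:R, N * F j%:R]%classic
  else `]N * F 0, +oo[%classic.

Let mband N k : measurable (band N k).
Proof. by case: k => [|k]; exact: measurable_itv. Qed.

Let bandP (N v : R) (k : nat) : 0 <= N -> (pos v /\ Q N v = k) <-> band N k v.
Proof.
move=> N0; have NF t : 0 <= N * F t by rewrite mulr_ge0 ?tail_ge0.
have posE : pos v = (0 < v) :> Prop by rewrite /= in_itv/= andbT.
rewrite posE; case: k => [|k] /=; rewrite in_itv/= ?andbT.
  split=> [[v0 Q0]|NFv].
    by rewrite -tail_quantile_le// Q0.
  have v0 : 0 < v by apply: le_lt_trans NFv.
  split=> //; apply/eqP; rewrite -leqn0 -(ler_nat R).
  by rewrite tail_quantile_le.
split=> [[v0 Qk]|/andP[NFv vNF]].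
  rewrite -tail_quantile_le// Qk lexx/= leNgt.
  by rewrite -tail_quantile_le// Qk ler_nat ltnn.
have v0 : 0 < v by apply: le_lt_trans NFv.
split=> //; apply/eqP; rewrite eqn_leq -!(ler_nat R) tail_quantile_le// NFv/=.
by rewrite ler_nat ltnNge -(ler_nat R) tail_quantile_le// -leNgt.
Qed.

Lemma measurable_tail_quantile d (T : measurableType d) (N : R) (h : nat -> T) :
  0 <= N -> measurable_fun pos (fun v => h (Q N v)).
Proof.
move=> N0 _ B mB.
rewrite (_ : _ `&` _ = \bigcup_(k in h @^-1` B) band N k).
  exact: bigcup_measurable.
apply/seteqP; split=> [v [vpos hB]|v [k hB /bandP[]]//].
  by exists (Q N v) => //; apply/bandP.
by move=> vpos Qk; split=> //; rewrite /preimage/= Qk.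
Qed.

(** The quantile takes the value [k + 1] on an interval of length
    [N * (F k - F (k + 1))], which is [N] times the mass at [k + 1]; it takes the
    value 0 on an unbounded interval, whence the condition on [h 0]. *)
Lemma integral_tail_quantile (N : R) (h : nat -> R) : 0 <= N ->
  (forall k, 0 <= h k) -> h 0%N = 0 ->
  (\int[leb]_(v in pos) (h (Q N v))%:E = N%:E * \int[mu]_k (h k)%:E)%E.
Proof.
move=> N0 h0 h00.
have posE : pos = \bigcup_k band N k.
  apply/seteqP; split=> [v vpos|v [k _ /(bandP _ _ N0)[]]//].
  by exists (Q N v) => //; apply/bandP.
rewrite integral_nat_series//.
rewrite -nneseriesZl; last first.
  by move=> k _; rewrite mule_ge0 ?lee_fin.
rewrite [in LHS]posE ge0_integral_bigcup//; last 3 first.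
- rewrite -posE; apply/measurable_EFinP.
  exact: measurable_tail_quantile.
- by move=> v _; rewrite lee_fin.
- by move=> i j _ _ [v [/(bandP _ _ N0)[_ <-] /(bandP _ _ N0)[_ <-]]].
apply: eq_eseriesr => k _.
rewrite (@eq_integral _ _ _ leb (band N k) (fun=> (h k)%:E)); last first.
  by move=> v; rewrite inE => /(bandP _ _ N0)[_ ->].
rewrite integral_cst//; case: k => [|k]; first by rewrite h00 !mul0e mule0.
rewrite muleCA; congr (_ * _)%E.
transitivity (leb (`]N * F k.+1%:R, N * F k%:R]%classic : set R)) => //.
rewrite lebesgue_measure_itv/= lte_fin.
have -> : mu [set k.+1] = (F k%:R - F k.+1%:R)%:E.
  rewrite EFinB !tailE.
  rewrite (_ : [set j : nat | k%:R < j%:R :> R] =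
    [set k.+1] `|` [set j : nat | k.+1%:R < j%:R :> R]); last first.
    apply/seteqP; split=> j /=; rewrite !ltr_nat.
      by rewrite leq_eqVlt => /orP[/eqP <-|]; [left|right].
    by move=> [->//|]; exact: ltnW.
  rewrite measureU//; last first.
    by apply/seteqP; split=> // j [/= ->]; rewrite ltxx.
  by rewrite addeK// fin_num_measure.
case: ltP => [_|]; first by rewrite -EFinM -EFinB mulrBr.
move=> NF; rewrite -EFinM; congr EFin; rewrite mulrBr; apply/esym/eqP.
rewrite subr_eq0 eq_le NF/=.
by rewrite ler_wpM2l// tail_nonincreasing// ler_nat.
all: by move=> *; exact: mband.
Qed.

(** The dominating function is integrable at infinity because [beta < 1]. *)
Lemma integrable_powRN_dom (C K beta : R) : 0 <= C -> 0 < K -> 0 < beta ->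
  beta < 1 ->
  leb.-integrable pos (fun v => (C * (if v <= K then 1
    else (v / K) `^ (- beta^-1)))%:E).
Proof.
move=> C0 K0 be0 be1.
pose r := beta^-1 - 1.
have r0 : 0 < r by rewrite subr_gt0 invf_gt1.
have r1E : - r - 1 = - beta^-1 by rewrite /r; ring.
pose c := C * K `^ (beta^-1) / r.
have c0 : 0 <= c by rewrite !mulr_ge0 ?powR_ge0// invr_ge0 ltW.
have G0 v : 0 <= C * (if v <= K then 1 else (v / K) `^ (- beta^-1)).
  by rewrite mulr_ge0//; case: ifP => _; rewrite ?powR_ge0.
have mG : measurable_fun pos (fun v => (C * (if v <= K then 1
    else (v / K) `^ (- beta^-1)))%:E).
  apply/measurable_EFinP/measurable_funTS; apply: measurable_funM => //.
  apply: measurable_fun_if => //.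
    by apply: measurable_fun_ler.
  apply: measurable_funTS; apply: (measurableT_comp (measurable_powR _)).
  exact: measurable_funM.
apply/integrableP; split=> //.
under eq_integral do rewrite gee0_abs ?lee_fin//.
have posE : pos = `]0, K] `|` `]K, +oo[.
  by rewrite -itv_bndbnd_setU// bnd_simp// ltW.
rewrite [in X in (X < _)%E]posE ge0_integral_setU//; last 3 first.
- by rewrite -posE.
- by move=> v _; rewrite lee_fin.
- apply/disj_setPS => v []/=; rewrite !in_itv/= andbT => /andP[_ vK].
  by rewrite ltNge vK.
rewrite (eq_integral (fun=> C%:E)); last first.
  by move=> v; rewrite inE/= in_itv/= => /andP[_ ->]; rewrite mulr1.
rewrite integral_cst//= [X in (_ * X)%E](_ : _ = leb (`]0, K]%classic : set R))//.
rewrite lebesgue_measure_itv/= lte_fin K0 -EFinB -EFinM.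
rewrite [X in (_ + X)%E](_ : _ = \int[leb]_(v in `]K, +oo[)
    (c%:E * (r * v `^ (- r - 1))%:E))%E; last first.
  apply: eq_integral => v; rewrite inE/= in_itv/= andbT => Kv.
  rewrite leNgt Kv/= -EFinM; congr EFin; have v0 := lt_trans K0 Kv.
  rewrite powRM ?invr_ge0 ?(ltW v0) ?(ltW K0)//.
  rewrite -(powR_inv1 (ltW K0)) -powRrM mulN1r opprK r1E /c.
  by field; rewrite gt_eqF.
rewrite ge0_integralZl//; last 2 first.
- by apply/measurable_EFinP/measurable_funTS; exact: measurable_funM.
- by move=> v _; rewrite lee_fin mulr_ge0 ?powR_ge0// ltW.
by rewrite integral_powRN_tail// -EFinM -EFinD ltry.
Qed.

(** Dominated convergence in the quantile coordinate: the bound on [h] becomes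
    [C] near [v = 0] and [tail_quantile_dom] provides the decay at infinity. *)
Lemma tail_quantile_integral_cvg (h : nat -> nat -> R) (C : R) (g : R -> R) :
  0 <= C ->
  (\forall n \near \oo, forall k,
    0 <= h n k <= C * Num.min 1 (k%:R / b n)) ->
  measurable_fun pos g ->
  {ae leb, forall v, pos v -> h n (Q n%:R v) @[n --> \oo] --> g v} ->
  leb.-integrable pos (EFin \o g) /\
  n%:R * \int[mu]_k h n k @[n --> \oo] --> \int[leb]_(v in pos) g v.
Proof.
move=> C0 hC mg hg.
(* any exponent strictly between [alpha] and 1 would do *)
pose beta := (alpha + 1) / 2.
have ab : alpha < beta by rewrite /beta midf_lt.
have b1 : beta < 1 by rewrite /beta midf_lt.
have be0 : 0 < beta := lt_trans alpha0 ab.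
have [K K0 HK] := tail_quantile_dom ab b1.
have [n0 _ Hn0] : \forall n \near \oo, 0 < b n /\
    (forall k, 0 <= h n k <= C * Num.min 1 (k%:R / b n)) /\
    (forall v, K <= v -> (Q n%:R v)%:R / b n <= (v / K) `^ (- beta^-1)).
  near=> n; split; last split.
  - by near: n; move/cvgryPgt : quantile_cvg_pinfty; apply.
  - by near: n.
  - by near: n.
have {}Hn0 n : 0 < b (n + n0)%N /\
    (forall k, 0 <= h (n + n0)%N k <= C * Num.min 1 (k%:R / b (n + n0)%N)) /\
    (forall v, K <= v ->
      (Q (n + n0)%:R v)%:R / b (n + n0)%N <= (v / K) `^ (- beta^-1)).
  by apply: Hn0 => /=; rewrite leq_addl.
pose G (v : R) : R := C * (if v <= K then 1 else (v / K) `^ (- beta^-1)).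
have Gint : leb.-integrable pos (EFin \o G) by exact: integrable_powRN_dom.
pose f_ n v := (h (n + n0)%N (Q (n + n0)%:R v))%:E.
have := @dominated_convergence _ _ _ leb pos (measurable_itv _) f_
  (EFin \o g) (EFin \o G).
case.
- move=> n; apply/measurable_EFinP; exact: measurable_tail_quantile.
- exact/measurable_EFinP.
- apply: negligibleS hg => v; apply: contra_not => hv vpos.
  apply: cvg_EFin; first exact: nearW.
  have := hv vpos; rewrite -(cvg_shiftn n0); exact.
- exact: Gint.
- apply: aeW => v n vpos.
  have [bn0 [hb Qb]] := Hn0 n.
  have /andP[h0 h1] := hb (Q (n + n0)%:R v).
  rewrite /f_ lee_fin ger0_norm//= (le_trans h1)// /G ler_wpM2l//.
  case: ifPn => [_|]; first by rewrite ge_min lexx.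
  by rewrite -ltNge => /ltW/Qb; rewrite ge_min => ->; rewrite orbT.
move=> gint _ cvgint; split=> //.
rewrite -(cvg_shiftn n0)/=.
have E n : (\int[leb]_(v in pos) f_ n v =
    ((n + n0)%:R * \int[mu]_k h (n + n0)%N k)%:E)%E.
  have [bn0 [hb _]] := Hn0 n.
  rewrite /f_ integral_tail_quantile//; last 2 first.
  - by move=> k; have /andP[] := hb k.
  - by apply/eqP; rewrite eq_le; have := hb 0%N; rewrite mul0r (min_idPr _)// mulr0 andbC.
  rewrite EFinM /Rintegral fineK//; apply: integrable_fin_num => //.
  apply: (integrable_bounded_prob mu (C := C)) => // k _.
  have /andP[h0 h1] := hb k.
  rewrite ger0_norm// (le_trans h1)// -[leRHS]mulr1 ler_wpM2l//.
  by rewrite ge_min lexx.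
have Ef n : (n + n0)%:R * \int[mu]_k h (n + n0)%N k =
    fine (\int[leb]_(v in pos) f_ n v)%E by rewrite E.
under eq_cvg do rewrite Ef.
apply: (fine_cvg (f := fun n => \int[leb]_(v in pos) f_ n v)%E).
by rewrite /Rintegral fineK//; exact: integrable_fin_num.
Unshelve. all: by end_near. Qed.

End RegularVariation.

(** * Limits of powers and the exponent of the thinned sum *)

Section PowerLimits.
Context {R : realType}.

Lemma expr_onem_bounds (w : R) (k : nat) : 0 <= w -> w < 1 ->
  expR (- (k%:R * w / (1 - w))) <= (1 - w) ^+ k <= expR (- (k%:R * w)).
Proof.
move=> w0 w1; have w10 : 0 < 1 - w by rewrite subr_gt0.
apply/andP; split.
  rewrite -mulrA -mulrN expRM_natl.
  rewrite lerXn2r ?nnegrE ?expR_ge0 ?(ltW w10)//.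
  rewrite expRN -[leRHS]invrK lef_pV2 ?posrE ?invr_gt0 ?expR_gt0//.
  apply: le_trans (expR_ge1Dx _).
  by rewrite le_eqVlt; apply/orP; left; apply/eqP; field; rewrite gt_eqF.
rewrite -mulrN expRM_natl lerXn2r ?nnegrE ?expR_ge0 ?(ltW w10)//.
exact: le_trans (expR_ge1Dx _).
Qed.

Lemma expr_onem_cvg (w : nat -> R) (k : nat -> nat) (l : R) :
  (\forall n \near \oo, 0 <= w n) -> w n @[n --> \oo] --> (0 : R) ->
  (k n)%:R * w n @[n --> \oo] --> l ->
  (1 - w n) ^+ k n @[n --> \oo] --> expR (- l).
Proof.
move=> w0 wc kwc.
have w1 : \forall n \near \oo, w n < 1.
  by move/cvgr_lt : wc; apply.
apply: (@squeeze_cvgr _ _ _ _ (fun n => expR (- ((k n)%:R * w n / (1 - w n))))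
  (fun n => expR (- ((k n)%:R * w n)))).
- by near=> n; apply: expr_onem_bounds; near: n.
- apply: continuous_cvg; first exact: continuous_expR.
  apply: cvgN.
  rewrite -[X in _ --> X]mulr1; apply: cvgM => //.
  rewrite -[X in _ --> X]invr1; apply: cvgV; first exact: oner_neq0.
  by rewrite -[X in _ --> X]subr0; apply: cvgB => //; exact: cvg_cst.
- apply: continuous_cvg; first exact: continuous_expR.
  exact: cvgN.
Unshelve. all: by end_near. Qed.

Lemma onem_expr_le (w : R) (k : nat) : 0 <= w -> w <= 1 ->
  1 - (1 - w) ^+ k <= k%:R * w.
Proof.
move=> w0 w1; elim: k => [|k IH]; first by rewrite expr0 subrr mul0r.
rewrite exprS -natr1 mulrDl mul1r.
have : (1 - w) ^+ k <= 1 by rewrite exprn_ile1 ?subr_ge0// gerBl.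
have : 0 <= (1 - w) ^+ k by rewrite exprn_ge0 ?subr_ge0.
nra.
Qed.

End PowerLimits.

Section ThinnedLaplace.
Context {R : realType}.
Variables (mu : probability nat R) (alpha : R) (L q : R -> R).
Hypotheses (alpha0 : 0 < alpha) (alpha1 : alpha < 1).
Hypothesis mu_tail : forall t : R, 0 < t ->
  mu [set k : nat | t < k%:R] = (t `^ (- alpha) * L t)%:E.
Hypothesis slowL : slowly_varying L.
Variable (C : R).
Hypothesis q0 : forall x, 0 <= x -> 0 <= q x.
Hypothesis qC : forall x, 0 <= x -> q x <= C.
Local Notation b := (fun n : nat => gen_inverse (fun t : R => t `^ alpha / L t) n%:R).
Local Notation leb := (@lebesgue_measure R).
Local Notation pos := (`]0, +oo[%classic : set R).

(** Since [1 - (1 - w) ^+ k] is at most [1] and at most [k * w], the integrand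
    satisfies the domination hypothesis of [tail_quantile_integral_cvg]. *)
Lemma thinned_exponent_cvg (ell : nat -> R) (g : R -> R) (u : R) :
  (forall n, 0 < ell n) -> 0 < u -> u <= 1 -> measurable_fun pos g ->
  {ae leb, forall v, pos v ->
    q ((tail_quantile mu n%:R v)%:R / ell n) @[n --> \oo] --> g v} ->
  leb.-integrable pos
    (EFin \o (fun v => g v * (1 - expR (- (u * v `^ (- alpha^-1)))))) /\
  n%:R * \int[mu]_k (rescale q (ell n) k%:R * (1 - (1 - u / b n) ^+ k))
    @[n --> \oo] -->
  \int[leb]_(v in pos) (g v * (1 - expR (- (u * v `^ (- alpha^-1))))).
Proof.
move=> ell0 u0 u1 mg hg.
have C0 : 0 <= C := le_trans (q0 (lexx 0)) (qC (lexx 0)).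
have by_ := @quantile_cvg_pinfty _ _ _ _ mu_tail slowL.
have w0 : u / b n @[n --> \oo] --> (0 : R).
  rewrite -[X in _ --> X](mulr0 u); apply: cvgMr.
  apply/cvgrPdist_lt => e e0; near=> n.
  have b0 : 0 < b n by near: n; move/cvgryPgt : by_; apply.
  rewrite sub0r normrN gtr0_norm ?invr_gt0// invf_plt ?posrE//.
  by near: n; move/cvgryPgt : by_; apply.
apply: (tail_quantile_integral_cvg alpha0 alpha1 mu_tail slowL
  (h := fun n k => rescale q (ell n) k%:R * (1 - (1 - u / b n) ^+ k)) C0).
- near=> n => k.
  have b1 : 1 < b n by near: n; move/cvgryPgt : by_; apply.
  have b0 := lt_trans ltr01 b1.
  have k0 : (0 : R) <= k%:R / ell n by rewrite divr_ge0// ltW.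
  have wn0 : 0 <= u / b n by rewrite divr_ge0// ltW.
  have wn1 : u / b n <= 1 by rewrite ler_pdivrMr// mul1r (le_trans u1)// ltW.
  have onw : 0 <= 1 - u / b n by rewrite subr_ge0.
  have onw1 : 1 - u / b n <= 1 by rewrite gerBl.
  have f0 : 0 <= 1 - (1 - u / b n) ^+ k by rewrite subr_ge0 exprn_ile1.
  rewrite mulr_ge0 ?q0//=; apply: ler_pM => //; [exact: q0|exact: qC|].
  rewrite le_min gerBl exprn_ge0//= (le_trans (onem_expr_le _ _ _))//.
  by rewrite ler_wpM2l// ler_pdivrMr// mulVf ?gt_eqF.
- apply: measurable_funM => //; apply: measurable_funTS.
  apply: measurable_funB => //; apply: measurableT_comp => //.
  by apply: measurableT_comp => //; apply: measurable_funM.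
- apply: negligibleS hg => v; apply: contra_not => hv vpos.
  have v0 : 0 < v by move: vpos; rewrite /= in_itv/= andbT.
  apply: cvgM; first exact: hv.
  apply: cvgB; first exact: cvg_cst.
  apply: expr_onem_cvg => //.
    near=> n; rewrite divr_ge0 ?(ltW u0)// ltW//.
    by near: n; move/cvgryPgt : by_; apply.
  have := tail_quantile_cvg alpha0 mu_tail slowL v0.
  move=> Qv; have : u * ((tail_quantile mu n%:R v)%:R / b n) @[n --> \oo] --> u * v `^ (- alpha^-1).
    by apply: cvgMr.
  by under eq_cvg do rewrite mulrCA.

Unshelve. all: by end_near. Qed.

End ThinnedLaplace.

(** * Independent variables with natural values *)

Section NatVariables.
Context d (Omega : measurableType d) (R : realType) (P : probability Omega R).
Local Open Scope ereal_scope.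

Lemma measurable_preimage_nat (X : Omega -> nat) (A : set nat) :
  measurable_fun setT X -> measurable (X @^-1` A).
Proof. by move=> mX; rewrite -[X in measurable X]setTI; exact: mX. Qed.

Lemma ge0_nneseriesZr (f : nat -> \bar R) (x : \bar R) :
  (forall k, 0 <= f k) -> 0 <= x ->
  (\sum_(0 <= k <oo) f k) * x = \sum_(0 <= k <oo) f k * x.
Proof.
move=> f0 x0; rewrite -!ge0_integral_count//; last by move=> k; rewrite mule_ge0.
by rewrite ge0_integralZr.
Qed.

Lemma integral_split_nat (X : Omega -> nat) (B : set Omega) (f : Omega -> \bar R) :
  measurable_fun setT X -> measurable B -> measurable_fun B f ->
  (forall w, 0 <= f w) ->
  \int[P]_(w in B) f w =
  \sum_(0 <= k <oo) \int[P]_(w in B `&` X @^-1` [set k]) f w.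
Proof.
move=> mX mB mf f0.
have BE : B = \bigcup_k (B `&` X @^-1` [set k]).
  by apply/seteqP; split=> [w Bw|w [k _ []]//]; exists (X w).
rewrite [LHS](_ : _ =
    \int[P]_(w in \bigcup_k (B `&` X @^-1` [set k])) f w); last by rewrite -BE.
rewrite ge0_integral_bigcup//.
- by move=> k; apply: measurableI => //; exact: measurable_preimage_nat.
- by rewrite -BE.
- by move=> i j _ _ [w [[_ /= <-] [_ /= <-]]].
Qed.

Lemma integral_nat_var (X : Omega -> nat) (f : nat -> R) :
  measurable_fun setT X -> (forall k, (0 <= f k)%R) ->
  \int[P]_w (f (X w))%:E = \sum_(0 <= k <oo) (f k)%:E * P (X @^-1` [set k]).
Proof.
move=> mX f0.
rewrite (@integral_split_nat X)//; last 2 first.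
- by apply/measurable_EFinP; exact: (measurableT_comp (f := f)).
- by move=> w; rewrite lee_fin.
apply: eq_eseriesr => k _; rewrite setTI.
rewrite (@eq_integral _ _ _ _ _ (fun=> (f k)%:E)); last first.
  by move=> w; rewrite inE/= => ->.
by rewrite integral_cst//; exact: measurable_preimage_nat.
Qed.

Lemma measurable_mixture (S : Omega -> nat) (Z : nat -> Omega -> nat) :
  measurable_fun setT S -> (forall k, measurable_fun setT (Z k)) ->
  measurable_fun setT (fun w => Z (S w) w).
Proof.
move=> mS mZ _ B _; rewrite setTI.
rewrite (_ : _ @^-1` _ = \bigcup_k (S @^-1` [set k] `&` Z k @^-1` B)).
  apply: bigcup_measurable => k _.
  by apply: measurableI; exact: measurable_preimage_nat.
by apply/seteqP; split=> [w Bw|w [k _ [/= <-]]//]; exists (S w).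
Qed.

(** If the event that [S] equals [k] is independent of [Z k] for each [k], the
    variable [Z (S w) w] has the mixture of the laws of the [Z k] with weights
    given by the law of [S]. *)
Lemma integral_mixture (S : Omega -> nat) (Z : nat -> Omega -> nat)
    (f : nat -> R) :
  measurable_fun setT S -> (forall k, measurable_fun setT (Z k)) ->
  (forall k, (0 <= f k)%R) ->
  (forall k j, P (S @^-1` [set k] `&` Z k @^-1` [set j]) =
               P (S @^-1` [set k]) * P (Z k @^-1` [set j])) ->
  \int[P]_w (f (Z (S w) w))%:E =
  \sum_(0 <= k <oo) (\int[P]_w (f (Z k w))%:E) * P (S @^-1` [set k]).
Proof.
move=> mS mZ f0 ind; have mZS := measurable_mixture mS mZ.
rewrite (@integral_split_nat S)//; last 2 first.
- by apply/measurable_EFinP; exact: (measurableT_comp (f := f)).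
- by move=> w; rewrite lee_fin.
apply: eq_eseriesr => k _; rewrite setTI.
rewrite (@eq_integral _ _ _ _ _ (fun w => (f (Z k w))%:E)); last first.
  by move=> w; rewrite inE/= => ->.
rewrite [LHS](@integral_split_nat (Z k))//; last 3 first.
- exact: measurable_preimage_nat.
- by apply/measurable_EFinP/measurable_funTS; exact: (measurableT_comp (f := f)).
- by move=> w; rewrite lee_fin.
rewrite integral_nat_var// ge0_nneseriesZr//; last first.
  by move=> j; rewrite mule_ge0 ?lee_fin.
apply: eq_eseriesr => j _.
rewrite (@eq_integral _ _ _ _ _ (fun=> (f j)%:E)); last first.
  by move=> w; rewrite inE/= => -[_ ->].
rewrite integral_cst/=; last first.
  by apply: measurableI; exact: measurable_preimage_nat.
by rewrite ind muleCA muleC.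
Qed.

(** Independence is a statement on events; it is transferred to functions by
    decomposing one variable at a time along its values, each of which is moved
    from the list of functions [J] to a list [K] of events. *)
Lemma integral_prod_independent (I : eqType) (X : I -> Omega -> nat)
    (f : I -> nat -> R) (J : seq I) :
  (forall i, measurable_fun setT (X i)) -> (forall i k, (0 <= f i k)%R) ->
  mutually_independent P X -> uniq J ->
  \int[P]_w (\prod_(i <- J) f i (X i w))%R%:E =
  \prod_(i <- J) \int[P]_w (f i (X i w))%:E.
Proof.
move=> mX f0 ind uJ.
have mB (A : I -> set nat) K : measurable (\big[setI/setT]_(i <- K) (X i @^-1` A i)).
  by apply: bigsetI_measurable => i _; exact: measurable_preimage_nat.
have mF K : measurable_fun setT (fun w => (\prod_(i <- K) f i (X i w))%R%:E).
  apply/measurable_EFinP; apply: measurable_prod => i _.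
  exact: (measurableT_comp (f := f i)).
have F0 K w : (0 <= \prod_(i <- K) f i (X i w))%R by rewrite prodr_ge0.
suff gen K (A : I -> set nat) : uniq (J ++ K) ->
    \int[P]_(w in \big[setI/setT]_(i <- K) (X i @^-1` A i))
      (\prod_(i <- J) f i (X i w))%R%:E =
    (\prod_(i <- J) \int[P]_w (f i (X i w))%:E) *
    \prod_(i <- K) P (X i @^-1` A i).
  have := gen [::] (fun=> setT); rewrite cats0 !big_nil mule1; exact.
elim: J {uJ} K A => [|j J IH] K A /= uJK.
  rewrite big_nil mul1e -ind//.
  under eq_integral do rewrite big_nil.
  by rewrite integral_cst// mul1e.
rewrite [LHS](@integral_split_nat (X j))//; last 2 first.
- exact: measurable_funTS.
- by move=> w; rewrite lee_fin.
move: uJK; rewrite mem_cat negb_or -andbA => /and3P[jJ jK uJK].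
rewrite big_cons integral_nat_var// -muleA ge0_nneseriesZr//; last 2 first.
- by move=> k; rewrite mule_ge0 ?lee_fin.
- rewrite mule_ge0 ?prode_ge0// => i _.
  by apply: integral_ge0 => w _; rewrite lee_fin.
apply: eq_eseriesr => k _.
pose A' i := if i == j then [set k] else A i.
have A'K : \big[setI/setT]_(i <- K) (X i @^-1` A i) `&` X j @^-1` [set k] =
    \big[setI/setT]_(i <- j :: K) (X i @^-1` A' i).
  rewrite big_cons setIC /A' eqxx; congr (_ `&` _).
  apply: eq_big_seq => i iK; rewrite ifF//.
  by apply/negP => /eqP ij; rewrite ij in iK; rewrite iK in jK.
rewrite A'K (@eq_integral _ _ _ _ _
  (fun w => (f j k)%:E * (\prod_(i <- J) f i (X i w))%R%:E)); last first.
  move=> w; rewrite -A'K inE/= => -[_ Xk].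
  by rewrite big_cons EFinM Xk.
rewrite ge0_integralZl//; last 3 first.
- exact: measurable_funTS.
- by move=> w _; rewrite lee_fin.
- by rewrite lee_fin.
rewrite IH; last first.
  by rewrite uniq_catC/= mem_cat negb_or jK jJ uniq_catC.
rewrite big_cons {1}/A' eqxx.
have -> : \prod_(i <- K) P (X i @^-1` A' i) = \prod_(i <- K) P (X i @^-1` A i).
  apply: eq_big_seq => i iK; rewrite /A' ifF//.
  by apply/negP => /eqP ij; rewrite ij in iK; rewrite iK in jK.
by rewrite !muleA; congr (_ * _); rewrite muleAC.
Qed.

End NatVariables.

(** * Thinning and sums of tempered variables *)

Section Thinning.
Context d (Omega : measurableType d) (R : realType) (P : probability Omega R).
Implicit Types (s g : R).

Lemma measurable_sumn (I : Type) d' (T : measurableType d') (X : I -> T -> nat)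
    (J : seq I) :
  (forall i, measurable_fun setT (X i)) ->
  measurable_fun setT (fun w => \sum_(i <- J) X i w)%N.
Proof.
move=> mX; elim: J => [|i J IH].
  by under eq_fun do rewrite big_nil; exact: measurable_cst.
by under eq_fun do rewrite big_cons; exact: measurable_fun_addn.
Qed.

(** A variable with masses [g] at 1 and [1 - g] at 0 has no other atoms. *)
Lemma pgf_bernoulli (X : {RV P >-> nat}) g s :
  P (X @^-1` [set 1%N]) = g%:E -> P (X @^-1` [set 0%N]) = (1 - g)%:E ->
  0 <= s -> s <= 1 ->
  (\int[P]_w (s ^+ X w)%:E = (1 - g * (1 - s))%:E)%E.
Proof.
move=> X1 X0 s0 s1.
have sk k : `|s ^+ k| <= 1 by rewrite ger0_norm ?exprn_ge0// exprn_ile1.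
have -> : (\int[P]_w (s ^+ X w)%:E =
    \int[distribution P X]_k (s ^+ k)%:E)%E.
  by rewrite ge0_integral_distribution// => k; rewrite lee_fin exprn_ge0.
have sint : (distribution P X).-integrable setT (EFin \o (fun k => s ^+ k)).
  exact: (integrable_bounded_prob (distribution P X) (C := 1)).
rewrite -[LHS]fineK; last exact: integrable_fin_num.
congr EFin; rewrite -/(Rintegral (distribution P X) setT (fun k => s ^+ k)).
rewrite (@Rintegral_nat_sum _ _ _ 1 2)//.
have M0 : fine (distribution P X [set 0%N]) = 1 - g by rewrite [X in fine X]X0.
have M1 : fine (distribution P X [set 1%N]) = g by rewrite [X in fine X]X1.
have := mass_sum_tail (distribution P X) 2.
rewrite !big_ord_recl !big_ord0/= /bump/= M0 M1 => Mt.
have T0 : fine (distribution P X [set k | (2 <= k)%N]) = 0 by lra.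
have := @Rintegral_prob_le R 1 _ _ (distribution P X) [set k | (2 <= k)%N]
  (fun k => s ^+ k) _ _ (fun k _ => sk k).
rewrite T0 mulr0 normr_le0 => /(_ _ _)/eqP ->//.
by rewrite expr0 expr1; ring.
Qed.

Lemma measurable_thin (S : Omega -> nat) (eps : nat -> {RV P >-> nat}) :
  measurable_fun setT S -> measurable_fun setT (thin S (fun i => eps i)).
Proof.
move=> mS; apply: (measurable_mixture mS (Z := fun k w => \sum_(i < k) eps i w)%N).
by move=> k; apply: measurable_sumn.
Qed.

(** Given [S], the thinned variable is a sum of [S] independent Bernoulli
    variables. *)
Lemma thin_pgf (S : Omega -> nat) (eps : nat -> {RV P >-> nat}) g s :
  measurable_fun setT S -> thinning_noise g S eps -> 0 <= s -> s <= 1 ->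
  (\int[P]_w (s ^+ thin S (fun i => eps i) w)%:E =
   \int[P]_w ((1 - g * (1 - s)) ^+ S w)%:E)%E.
Proof.
move=> mS [eps1 eps0 ind_eps indS] s0 s1.
pose Z k w := (\sum_(i < k) eps i w)%N.
have ZE k : Z k = fun w => (\sum_(i <- iota 0 k) eps i w)%N.
  by apply/funext => w; rewrite /Z -(big_mkord xpredT (fun i => eps i w)) /index_iota subn0.
have mZ k : measurable_fun setT (Z k).
  by rewrite ZE; apply: measurable_sumn => i; exact: measurable_funP.
have s_ge0 k : 0 <= s ^+ k by rewrite exprn_ge0.
have p0 : 0 <= 1 - g * (1 - s).
  have g1 : g <= 1.
    by rewrite -lee_fin -(eps1 0%N); apply: probability_le1; exact: measurable_preimage_nat.
  have g0 : 0 <= g by rewrite -lee_fin -(eps1 0%N).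
  nra.
rewrite (@integral_mixture _ _ _ P S Z (fun k => s ^+ k) mS mZ s_ge0); last first.
  move=> k j; apply: indS => //.
  (* [Z k] is measurable for the sigma-algebra generated by the noise *)
  set G := \bigcup_(i in setT) _.
  have meps i : measurable_fun (T := g_sigma_algebraType G) setT (eps i).
    move=> _ B mB; rewrite setTI; apply: sub_sigma_algebra.
    by exists i => //; exists B.
  have : measurable_fun (T := g_sigma_algebraType G) setT (Z k).
    by rewrite ZE; exact: measurable_sumn.
  by move=> /(_ measurableT [set j]); rewrite setTI; exact.
rewrite integral_nat_var//; last by move=> k; rewrite exprn_ge0.
apply: eq_eseriesr => k _; congr (_ * _)%E.
transitivity (\int[P]_w (\prod_(i <- iota 0 k) s ^+ eps i w)%:E)%E.
  apply: eq_integral => w _; rewrite ZE; congr EFin.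
  by elim: (iota 0 k) => [|i J IH]; rewrite ?big_nil ?big_cons// exprD IH.
rewrite (integral_prod_independent (f := fun _ k => s ^+ k) _ _ ind_eps (iota_uniq 0 k))//.
rewrite (eq_bigr (fun=> (1 - g * (1 - s))%:E)); last by move=> i _; exact: pgf_bernoulli.
rewrite prodEFin; congr EFin.
by rewrite big_const_seq count_predT size_iota iter_mulr_1.
Qed.

End Thinning.

Section TemperedSums.
Context {R : realType}.

(** As [P] has total mass 1, the generating function is 1 minus the integral of
    [1 - r ^+ k]; in this form the normalizing constant is only a factor. *)
Lemma pgf_tempered d (Omega : measurableType d) (P : probability Omega R)
    (mu : probability nat R) (q : R -> R) (l C r : R) (X : {RV P >-> nat}) :
  (forall x, 0 <= x -> 0 <= q x) -> (forall x, 0 <= x -> q x <= C) ->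
  0 < l -> (forall A, P (X @^-1` A) = tempered mu q l A) -> 0 <= r -> r <= 1 ->
  (\int[P]_w (r ^+ X w)%:E =
   (1 - temper_const mu q l *
        \int[mu]_k (rescale q l k%:R * (1 - r ^+ k)))%:E)%E.
Proof.
move=> q0 qC l0 XE r0 r1.
have r01 k : 0 <= r ^+ k <= 1 by rewrite exprn_ge0// exprn_ile1.
have Q0 (k : nat) : 0 <= rescale q l k%:R by rewrite q0// divr_ge0// ltW.
have C0 : 0 <= C := le_trans (q0 _ (lexx 0)) (qC _ (lexx 0)).
have f0 k : 0 <= 1 - r ^+ k by rewrite subr_ge0; have /andP[] := r01 k.
have g0 k : 0 <= rescale q l k%:R * (1 - r ^+ k) by rewrite mulr_ge0.
have c0 : 0 <= temper_const mu q l.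
  by rewrite /temper_const invr_ge0; apply: Rintegral_ge0 => k _.
have mf (f : nat -> R) : measurable_fun setT (fun w => (f (X w))%:E).
  apply/measurable_EFinP; apply: (measurableT_comp (f := f)) => //.
have I2 : (\int[P]_w (1 - r ^+ X w)%:E = (temper_const mu q l *
    \int[mu]_k (rescale q l k%:R * (1 - r ^+ k)))%:E)%E.
  rewrite EFinM /Rintegral fineK; last first.
    apply: integrable_fin_num => //.
    apply: (integrable_bounded_prob mu (C := C)) => // k _.
    rewrite ger0_norm// -[leRHS]mulr1 ler_pM//.
      by rewrite qC// divr_ge0// ltW.
    by rewrite gerBl; have /andP[] := r01 k.
  rewrite (integral_nat_var P (f := fun k => 1 - r ^+ k))//.
  rewrite integral_nat_series// -nneseriesZl; last first.
    by move=> k _; rewrite mule_ge0 ?lee_fin.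
  apply: eq_eseriesr => k _; rewrite XE /tempered muleCA; congr (_ * _)%E.
  rewrite (@eq_integral _ _ _ mu [set k] (fun=> (rescale q l k%:R)%:E)).
    by rewrite integral_cst// EFinM muleA (muleC (_%:E) (_%:E)).
  by move=> j; rewrite inE => ->.
have : (\int[P]_w (r ^+ X w)%:E + \int[P]_w (1 - r ^+ X w)%:E = 1)%E.
  rewrite -ge0_integralD//.
  - under eq_integral do rewrite -EFinD addrC subrK.
    by rewrite integral_cst// mul1e; exact: probability_setT.
  - by move=> w _; rewrite lee_fin; have /andP[] := r01 (X w).
  - by move=> w _; rewrite lee_fin f0.
  - exact: (mf (fun k => 1 - r ^+ k)).
rewrite I2 EFinB => <-; rewrite addeK//.
Qed.

Lemma pgf_sum d (Omega : measurableType d) (P : probability Omega R) (n : nat)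
    (X : 'I_n -> {RV P >-> nat}) (r p : R) :
  mutually_independent P (fun i => X i : Omega -> nat) -> 0 <= r ->
  (forall i, (\int[P]_w (r ^+ X i w)%:E = p%:E)%E) ->
  (\int[P]_w (r ^+ (\sum_(i < n) X i w)%N)%:E = (p ^+ n)%:E)%E.
Proof.
move=> ind r0 Xp.
transitivity (\int[P]_w (\prod_(i <- index_enum 'I_n) r ^+ X i w)%:E)%E.
  apply: eq_integral => w _; congr EFin.
  by elim: (index_enum _) => [|i J IH]; rewrite ?big_nil ?big_cons// exprD IH.
rewrite (integral_prod_independent (f := fun _ k => r ^+ k) _ _ ind)//.
- rewrite (eq_bigr (fun=> p%:E))//; rewrite prodEFin; congr EFin.
  by rewrite prodr_const card_ord.
- by move=> i k; rewrite exprn_ge0.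
- exact: index_enum_uniq.
Qed.

End TemperedSums.

(** * The Poisson process at an independent random time *)

Section PoissonTime.
Context {R : realType}.

Lemma poisson_prob_set1 (t : R) (k : nat) : 0 < t ->
  poisson_prob t 0%N [set k] = (t ^+ k * k`!%:R^-1 * expR (- t))%:E.
Proof.
by move=> t0; rewrite /poisson_prob t0 esum_set1 ?lee_fin ?poisson_pmf_ge0//
  /poisson_pmf t0.
Qed.

Lemma pgf_poisson (t s : R) : 0 < t -> 0 <= s ->
  (\sum_(0 <= k <oo) (s ^+ k)%:E * poisson_prob t 0%N [set k] =
   (expR (- ((1 - s) * t)))%:E)%E.
Proof.
move=> t0 s0.
under eq_eseriesr => k _.
  rewrite poisson_prob_set1// -EFinM.
  rewrite (_ : s ^+ k * _ = expR (- t) * ((s * t) ^+ k / k`!%:R)); last first.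
    by rewrite exprMn; ring.
  rewrite EFinM; over.
rewrite nneseriesZl; last first.
  by move=> k _; rewrite lee_fin divr_ge0// exprn_ge0// mulr_ge0// ltW.
rewrite [X in (_ * X)%E](_ : _ = (expR (s * t))%:E).
  by rewrite -EFinM -expRD; congr (expR _)%:E; ring.
rewrite expRE -EFin_lim; last first.
  rewrite /pseries/=; under eq_fun do rewrite mulrC.
  exact: is_cvg_series_exp_coeff.
apply/congr_lim/funext => n/=; rewrite /pseries/= /series/= -sumEFin//.
by under eq_bigr do rewrite mulrC.
Qed.

(** Discretizing the random time from the right turns [N (T w) w] into a
    mixture over countably many deterministic times, at which the Poisson law
    applies; the right continuity of the paths removes the discretization. *)
Lemma pgf_poisson_time d (Omega : measurableType d) (P : probability Omega R)
    (T : {RV P >-> R}) (N : R -> {RV P >-> nat}) (s : R) :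
  (forall w, 0 <= T w) -> unit_poisson_process N ->
  independent_of_family P T [set t | 0 <= t] (fun t => N t : Omega -> nat) ->
  0 <= s -> s <= 1 ->
  measurable_fun setT (fun w => N (T w) w) /\
  (\int[P]_w (s ^+ N (T w) w)%:E =
   \int[P]_w (expR (- ((1 - s) * T w)))%:E)%E.
Proof.
move=> T0 [N0 Nmono Nrc Nincr _] indT s0 s1.
have NP t : 0 < t -> forall A, P (N t @^-1` A) = poisson_prob t 0%N A.
  move=> t0 A; have := Nincr 0 t (lexx 0) (ltW t0) A; rewrite subr0 => <-.
  by congr (P _); apply/seteqP; split=> w /=; rewrite N0 subn0.
(* [Tm m] lies strictly to the right of [T], as right continuity of the paths is
   only stated along a punctured right neighbourhood *)
pose S m w := Num.truncn (m.+1%:R * T w).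
pose tt m (k : nat) : R := k.+1%:R / m.+1%:R.
have tt0 m k : 0 < tt m k by rewrite divr_gt0.
pose Tm m w := tt m (S m w).
have TTm m w : T w < Tm m w <= T w + m.+1%:R^-1.
  rewrite /Tm /tt /S; have mT : 0 <= m.+1%:R * T w by rewrite mulr_ge0.
  have /andP[h1 h2] := truncn_itv mT.
  rewrite ltr_pdivlMr// mulrC h2/= ler_pdivrMr// mulrDl mulVf ?pnatr_eq0//.
  by rewrite [T w * _]mulrC -natr1 lerD2r.
have Tm_cvg w : Tm m w @[m --> \oo] --> T w.
  apply: (@squeeze_cvgr _ _ _ _ (fun=> T w) (fun m => T w + m.+1%:R^-1)).
  - by near=> m; have /andP[/ltW -> ->] := TTm m w.
  - exact: cvg_cst.
  - rewrite -[X in _ --> X]addr0; apply: cvgD; first exact: cvg_cst.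
    exact: cvg_harmonic.
have NTm w : \forall m \near \oo, N (Tm m w) w = N (T w) w.
  have /= := Nrc w (T w) (T0 w).
  rewrite /at_right/= => -[e e0 He].
  have /cvgrPdist_lt/(_ _ e0) := Tm_cvg w; apply: filterS => m Hm.
  by apply: He => //; have /andP[] := TTm m w.
have s01 k : 0 <= s ^+ k <= 1 by rewrite exprn_ge0// exprn_ile1.
pose B m k := [set x : R | 0 <= x /\ Num.truncn (m.+1%:R * x) = k].
have mB m k : measurable (B m k).
  rewrite (_ : B m k = `[k%:R / m.+1%:R, k.+1%:R / m.+1%:R[%classic) //.
  have m0 : (0 : R) < m.+1%:R by [].
  apply/seteqP; split=> x /=; rewrite in_itv/= ler_pdivrMr// ltr_pdivlMr//.
    move=> [x0 <-]; rewrite ![x * _]mulrC; have mx : 0 <= m.+1%:R * x by rewrite mulr_ge0.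
    exact: truncn_itv.
  move=> /andP[kx xk]; have x0 : 0 <= x.
    by rewrite -(pmulr_lge0 _ m0) (le_trans _ kx).
  by split=> //; apply: truncn_def; rewrite ![_ * x]mulrC kx.
have SB m k : S m @^-1` [set k] = T @^-1` B m k.
  by apply/seteqP; split=> [w /= Sk|w [_ /=]]//; split.
have mS m : measurable_fun setT (S m).
  move=> _ A _; rewrite setTI (_ : _ @^-1` _ = \bigcup_(k in A) (S m @^-1` [set k])).
    apply: bigcup_measurable => k _; rewrite SB -[X in measurable X]setTI.
    exact: measurable_funP.
  by apply/seteqP; split=> [w Aw|w [k Ak /= ->]]//; exists (S m w).
have mN m : measurable_fun setT (fun w => N (Tm m w) w).
  exact: (measurable_mixture (mS m) (Z := fun k => N (tt m k))).
have mix m : (\int[P]_w (s ^+ N (Tm m w) w)%:E =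
     \int[P]_w (expR (- ((1 - s) * Tm m w)))%:E)%E.
  rewrite (@integral_mixture _ _ _ P (S m) (fun k => N (tt m k))
    (fun k => s ^+ k) (mS m)); last 3 first.
  - by move=> k; exact: measurable_funP.
  - by move=> k; have /andP[] := s01 k.
  - move=> k j.
    rewrite SB; apply: indT; first exact: mB.
    apply: sub_sigma_algebra; exists (tt m k); first by rewrite /= ltW.
    by exists [set j].
  rewrite (integral_nat_var P (f := fun k => expR (- ((1 - s) * tt m k))))//.
  apply: eq_eseriesr => k _; congr (_ * _)%E.
  rewrite -pgf_poisson// (integral_nat_var P (f := fun k => s ^+ k))//.
  - by apply: eq_eseriesr => j _; rewrite NP.
  - by move=> j; have /andP[] := s01 j.
have mNT : measurable_fun setT (fun w => N (T w) w).
  move=> _ A _; rewrite setTI.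
  have mR : measurable_fun setT (fun w => (N (T w) w)%:R : R).
    apply: (measurable_fun_cvg (h := fun m w => (N (Tm m w) w)%:R)).
      by move=> m; apply: (measurableT_comp (f := fun k : nat => k%:R : R)).
    move=> w _; apply: cvg_near_cst; move: (NTm w).
    by apply: filterS => m ->.
  have := mR measurableT [set k%:R | k in A].
  rewrite setTI (_ : (fun w => (N (T w) w)%:R : R) @^-1` _ = (fun w => N (T w) w) @^-1` A).
    apply; rewrite (_ : image _ _ = \bigcup_(k in A) [set k%:R]).
      exact: bigcup_measurable.
    by apply/seteqP; split=> [x [k Ak <-]|x [k Ak ->]]; exists k.
  apply/seteqP; split=> w /=; last by exists (N (T w) w).
  by move=> [k Ak /eqP]; rewrite eqr_nat => /eqP <-.
split=> //.
have one_int : P.-integrable setT (cst 1%E).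
  apply: (integrable_bounded_prob P (f := cst 1) (C := 1)) => // w _.
  by rewrite /= normr1.
have lhs : (\int[P]_w (s ^+ N (Tm m w) w)%:E)%E @[m --> \oo] -->
    (\int[P]_w (s ^+ N (T w) w)%:E)%E.
  apply: (dominated_cvg _ (g := cst 1%E)) => //.
  - by move=> m; apply/measurable_EFinP;
      apply: (measurableT_comp (f := fun k => s ^+ k)) => //.
  - move=> w _; apply: cvg_near_cst; move: (NTm w).
    by apply: filterS => m ->.
  - by move=> m w _; rewrite lee_fin; have /andP[h1 h2] := s01 (N (Tm m w) w); rewrite ger0_norm.
have rhs : (\int[P]_w (expR (- ((1 - s) * Tm m w)))%:E)%E @[m --> \oo] -->
    (\int[P]_w (expR (- ((1 - s) * T w)))%:E)%E.
  apply: (dominated_cvg _ (g := cst 1%E)) => //.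
  - move=> m; apply/measurable_EFinP.
    exact: (measurableT_comp (f := fun k => expR (- ((1 - s) * tt m k)))).
  - move=> w _; apply: cvg_EFin; first exact: nearW.
    apply: continuous_cvg; first exact: continuous_expR.
    by apply: cvgN; apply: cvgMr.
  - move=> m w _; rewrite lee_fin ger0_norm ?expR_ge0// -[leRHS]expR0 ler_expR oppr_le0.
    by apply: mulr_ge0; [rewrite subr_ge0|exact/ltW/tt0].
move: lhs; under eq_cvg do rewrite mix.
by move=> lhs; exact: (cvg_unique _ lhs rhs).
Unshelve. all: by end_near. Qed.

End PoissonTime.

(** * Generating functions of the limit laws *)

Section LaplaceOfLimit.
Context {R : realType}.
Local Notation leb := (@lebesgue_measure R).
Local Notation pos := (`]0, +oo[%classic : set R).
Implicit Types (alpha s : R) (q : R -> R) (nu : probability nat R).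

Lemma pgf_DTS alpha q nu s : 0 < alpha ->
  measurable_fun (`[0, +oo[ : set R) q -> (forall x, 0 <= x -> 0 <= q x) ->
  is_DTS alpha q alpha nu -> 0 < s -> s < 1 ->
  \int[nu]_k s ^+ k = expR (- \int[leb]_(v in pos)
    (q (v `^ (- alpha^-1)) * (1 - expR (- ((1 - s) * v `^ (- alpha^-1)))))).
Proof.
move=> al0 mq q0 [d [Om [P [T [N [T0 [M [ME [_ _ lapl]]] pois ind nuE]]]]]] s0 s1.
have s1' : 0 <= 1 - s by rewrite subr_ge0 ltW.
have sk k : 0 <= s ^+ k by rewrite exprn_ge0// ltW.
have [mNT pgfNT] := pgf_poisson_time T0 pois ind (ltW s0) (ltW s1).
have -> : \int[nu]_k s ^+ k = \int[distribution P T]_(x in `[0, +oo[) expR (- ((1 - s) * x)).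
  rewrite /Rintegral; congr fine.
  rewrite integral_nat_series; last by move=> k; rewrite lee_fin.
  transitivity (\int[P]_w (s ^+ N (T w) w)%:E)%E.
    rewrite (integral_nat_var P (f := fun k => s ^+ k))//.
    by apply: eq_eseriesr => k _; congr (_ * _)%E; exact: nuE.
  rewrite pgfNT ge0_integral_pushforward//; last first.
    apply/measurable_EFinP/measurable_funTS; apply: measurableT_comp => //.
    by apply: measurableT_comp => //; exact: measurable_funM.
  congr (integral _ _ _); apply/seteqP; split=> w //= _.
  by rewrite in_itv/= T0.
rewrite lapl//; congr (expR (- _)); rewrite /Rintegral; congr fine.
have mqpos : measurable_fun pos q.
  by apply: measurable_funS mq => //; apply: subset_itvr; rewrite bnd_simp.
have posP (x : R) : pos x -> 0 < x by rewrite /= in_itv/= andbT.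
pose wt := (fun x => alpha * q x * x `^ (- 1 - alpha)) \_ pos.
have mwt : measurable_fun setT (wt : measurableTypeR R -> R).
  apply/(measurable_restrictT _ _).1 => //.
  apply: measurable_funM; first exact: measurable_funM.
  by apply: measurable_funTS; exact: measurable_powR.
have wt0 x : 0 <= wt x.
  rewrite /wt patchE; case: ifPn => // /set_mem/posP x0.
  by rewrite !mulr_ge0 ?powR_ge0 ?q0// ltW.
have Mwt A : measurable A -> M A = (\int[leb]_(x in A) (wt x)%:E)%E.
  move=> mA; rewrite ME// integral_mkcondr; apply: eq_integral => x _.
  by rewrite /wt !patchE; case: ifP.
have mexp (D : set R) : measurable_fun D (fun x => 1 - expR (- ((1 - s) * x))).
  apply: measurable_funTS; apply: measurable_funB => //.
  by apply: measurableT_comp => //; apply: measurableT_comp => //; exact: measurable_funM.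
have exp0 x : 0 < x -> 0 <= 1 - expR (- ((1 - s) * x)).
  by move=> x0; rewrite subr_ge0 -[leRHS]expR0 ler_expR oppr_le0 mulr_ge0// ltW.
(* [M] and Lebesgue measure live on two copies of the Borel sets of the line
   with different displays: [M] is transported along the identity. *)
have mid : measurable_fun setT (fun x : R => x : measurableTypeR R).
  by move=> _ A mA; rewrite setTI.
pose M' : {measure set (measurableTypeR R) -> \bar R} :=
  image_measure M mid.
transitivity (\int[M']_(x in pos) (1 - expR (- ((1 - s) * x)))%:E)%E.
  apply/esym; apply: (ge0_integral_pushforward mid M) => //.
    by apply/measurable_EFinP; exact: mexp.
  by move=> x; rewrite inE => /posP/exp0; rewrite lee_fin.
rewrite (@integral_density _ (measurableTypeR R) R leb M' wt mwt wt0 Mwt)//; last 2 first.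
- by apply/measurable_EFinP; exact: mexp.
- by move=> x /posP x0; rewrite lee_fin exp0.
have mf : measurable_fun pos (fun x => (q x * (1 - expR (- ((1 - s) * x))))%:E).
  by apply/measurable_EFinP; exact: measurable_funM.
have f0 x : 0 < x -> (0 <= (q x * (1 - expR (- ((1 - s) * x))))%:E)%E.
  by move=> x0; rewrite lee_fin mulr_ge0 ?exp0// q0// ltW.
have := integral_power_subst al0 ltr01 mf f0; rewrite powR1 mul1e => E.
transitivity (\int[leb]_(x in pos) ((q x * (1 - expR (- ((1 - s) * x))))%:E *
    (alpha * x `^ (- alpha - 1))%:E))%E.
  apply: eq_integral => x xpos; rewrite /wt patchE xpos -!EFinM; congr EFin.
  by rewrite [- 1 - alpha]addrC; ring.
rewrite -E; apply: eq_integral => v _.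
by rewrite divr1.
Qed.

Lemma pgf_DS alpha eta nu s : 0 < alpha -> is_DS alpha (alpha * eta) nu ->
  0 < s -> s < 1 ->
  \int[nu]_k s ^+ k = expR (- (eta * \int[leb]_(v in pos)
    (1 - expR (- ((1 - s) * v `^ (- alpha^-1)))))).
Proof.
move=> al0 DS s0 s1; rewrite DS; last by rewrite gtr0_norm// ltW.
rewrite stable_exponent ?subr_gt0//; congr (expR (- _)).
by field; rewrite gt_eqF.
Qed.

End LaplaceOfLimit.

(** * Convergence of the thinned sums *)

Lemma cvg_within_comp {R : realType} (u : nat -> R) (D : set R) (x : R) :
  u n @[n --> \oo] --> x -> (\forall n \near \oo, D (u n)) ->
  u n @[n --> \oo] --> within D (nbhs x).
Proof.
move=> ux Du A /= DA; have := ux _ DA; rewrite /= !near_simpl.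
by move: Du; apply: filterS2 => n /= Dn; apply.
Qed.

Section TriangularArray.
Context {R : realType}.
Variables (mu : probability nat R) (alpha : R) (L q : R -> R) (ell : nat -> R).
Variables (d : nat -> measure_display) (Omega : forall n, measurableType (d n)).
Variables (P : forall n, probability (Omega n) R).
Variables (X : forall n, 'I_n -> {RV (P n) >-> nat}).
Variables (eps : forall n, nat -> {RV (P n) >-> nat}).
Hypotheses (alpha0 : 0 < alpha) (alpha1 : alpha < 1).
Hypothesis mu_tail : forall t : R, 0 < t ->
  mu [set k : nat | t < k%:R] = (t `^ (- alpha) * L t)%:E.
Hypothesis slowL : slowly_varying L.
Hypothesis temperingq : tempering_function alpha q.
Hypothesis temper1 : temper_const mu q l @[l --> +oo] --> (1 : R).
Hypotheses (ell0 : forall n, 0 < ell n) (elly : ell n @[n --> \oo] --> +oo).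

Local Notation V := (fun t : R => t `^ alpha / L t).
Local Notation b := (fun n : nat => gen_inverse V n%:R).
Local Notation S := (fun (n : nat) (w : Omega n) => (\sum_(i < n) X i w)%N).
Local Notation Y := (fun n : nat => thin (S n) (fun i => eps n i)).

Hypothesis lawX : \forall n \near \oo,
  (forall (i : 'I_n) (A : set nat),
     P n (X i @^-1` A) = tempered mu q (ell n) A) /\
  mutually_independent (P n) (fun i : 'I_n => X i : Omega n -> nat).
Hypothesis noise : \forall n \near \oo,
  thinning_noise ((b n)^-1) (S n) (eps n).

Local Notation leb := (@lebesgue_measure R).
Local Notation pos := (`]0, +oo[%classic : set R).

Let measurable_S n : measurable_fun setT (S n).
Proof. by apply: measurable_sumn => i; exact: measurable_funP. Qed.

Let measurable_Y n : measurable_fun setT (Y n).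
Proof. exact: measurable_thin. Qed.

Let YRV n : {RV (P n) >-> nat} :=
  HB.pack (Y n) (isMeasurableFun.Build _ _ _ _ _ (@measurable_Y n)).

(** The function [g] is the limit of the tempering factor in the quantile
    coordinate; the hypotheses on it are those in which the three regimes
    differ. *)
Lemma thinned_sum_pgf_cvg (g : R -> R) (s : R) : 0 < s -> s < 1 ->
  measurable_fun pos g ->
  {ae leb, forall v, pos v ->
    q ((tail_quantile mu n%:R v)%:R / ell n) @[n --> \oo] --> g v} ->
  \int[distribution (P n) (YRV n)]_k s ^+ k @[n --> \oo] -->
  expR (- \int[leb]_(v in pos)
    (g v * (1 - expR (- ((1 - s) * v `^ (- alpha^-1)))))).
Proof.
move=> s0 s1 mg qg.
have [_ q0 [C qC] _ _] := temperingq.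
have u0 : 0 < 1 - s by rewrite subr_gt0.
have u1 : 1 - s <= 1 by rewrite gerBl ltW.
have [_ Icvg] := thinned_exponent_cvg alpha0 alpha1 mu_tail slowL q0 qC ell0 u0 u1 mg qg.
pose r n := 1 - (1 - s) / b n.
pose I n := \int[mu]_k (rescale q (ell n) k%:R * (1 - r n ^+ k)).
pose c n := temper_const mu q (ell n).
have c1 : c n @[n --> \oo] --> (1 : R) by apply: cvg_comp temper1; exact: elly.
have b0 : \forall n \near \oo, 1 <= b n.
  by move/cvgryPge : (@quantile_cvg_pinfty _ _ _ _ mu_tail slowL); apply.
have r01 : \forall n \near \oo, 0 <= r n /\ r n <= 1.
  move: b0; apply: filterS => n b1; rewrite /r subr_ge0 gerBl.
  have b00 : 0 < b n by rewrite (lt_le_trans ltr01).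
  by rewrite ler_pdivrMr// mul1r (le_trans u1)// divr_ge0// ltW.
have pgfE : \forall n \near \oo, (1 - c n * I n) ^+ n =
    \int[distribution (P n) (YRV n)]_k s ^+ k.
  near=> n.
  have [lawXn indX] : (forall (i : 'I_n) (A : set nat),
      P n (X i @^-1` A) = tempered mu q (ell n) A) /\
      mutually_independent (P n) (fun i : 'I_n => X i : Omega n -> nat) by near: n.
  have noisen : thinning_noise ((b n)^-1) (S n) (eps n) by near: n.
  have [r0 r1] : 0 <= r n /\ r n <= 1 by near: n.
  rewrite /Rintegral ge0_integral_distribution//; last first.
    by move=> k; rewrite lee_fin exprn_ge0// ltW.
  rewrite [X in fine X](thin_pgf (@measurable_S n) noisen (ltW s0) (ltW s1)).
  rewrite (_ : 1 - (b n)^-1 * (1 - s) = r n); last by rewrite /r mulrC.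
  rewrite (pgf_sum (p := 1 - c n * I n) indX r0)// => i.
  exact: (pgf_tempered q0 qC (ell0 n) (lawXn i) r0 r1).
apply: cvg_trans (near_eq_cvg pgfE) _.
pose Lam := \int[leb]_(v in pos)
  (g v * (1 - expR (- ((1 - s) * v `^ (- alpha^-1))))).
have ncI : n%:R * (c n * I n) @[n --> \oo] --> Lam.
  have : c n * (n%:R * I n) @[n --> \oo] --> 1 * Lam by apply: cvgM.
  by rewrite mul1r; under eq_cvg do rewrite mulrCA.
apply: (expr_onem_cvg (w := fun n => c n * I n) (k := id)) => //.
- move: r01; apply: filterS => n [r0 r1]; apply: mulr_ge0.
    rewrite /c /temper_const invr_ge0; apply: Rintegral_ge0 => k _.
    by rewrite q0// divr_ge0// ltW.
  apply: Rintegral_ge0 => k _; rewrite mulr_ge0//.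
    by rewrite q0// divr_ge0// ltW.
  by rewrite subr_ge0 exprn_ile1.
(* [c n * I n] tends to 0 because [n%:R * (c n * I n)] converges *)
- have : n%:R^-1 * (n%:R * (c n * I n)) @[n --> \oo] --> 0 * Lam.
    by apply: cvgM => //; rewrite -cvg_shiftS; exact: cvg_harmonic.
  rewrite mul0r; apply: cvg_trans; apply: near_eq_cvg; near=> n.
  rewrite mulKf// pnatr_eq0 -lt0n.
  by near: n; exact: nbhs_infty_gt.
Unshelve. all: by end_near. Qed.

Lemma thinned_sum_cvg (g : R -> R) (nu : probability nat R) :
  measurable_fun pos g ->
  {ae leb, forall v, pos v ->
    q ((tail_quantile mu n%:R v)%:R / ell n) @[n --> \oo] --> g v} ->
  (forall s, 0 < s -> s < 1 -> \int[nu]_k s ^+ k = expR (- \int[leb]_(v in pos)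
    (g v * (1 - expR (- ((1 - s) * v `^ (- alpha^-1))))))) ->
  cvg_in_distribution P Y nu.
Proof.
move=> mg qg nuE f cf [C fC].
have h := @pgf_cvg_integral R (fun n => distribution (P n) (YRV n)) nu.
have : \int[distribution (P n) (YRV n)]_k f k%:R @[n --> \oo] -->
    \int[nu]_k f k%:R.
  apply: (h _ (fun k => f k%:R) C) => // s s0 s1.
  by rewrite nuE//; exact: thinned_sum_pgf_cvg.
apply: cvg_trans; apply: near_eq_cvg; apply: nearW => n.
rewrite /Rintegral integral_distribution//.
apply: (integrable_bounded_prob (P n) (f := fun w => f (YRV n w)%:R) (C := C)) => //.
exact: (measurableT_comp (f := fun k : nat => f k%:R)).
Qed.

End TriangularArray.

Theorem theorem11 (R : realType) (alpha : R) (mu : probability nat R)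
    (L q : R -> R) (ell : nat -> R)
    (d : nat -> measure_display) (Omega : forall n, measurableType (d n))
    (P : forall n, probability (Omega n) R)
    (X : forall n, 'I_n -> {RV (P n) >-> nat})
    (eps : forall n, nat -> {RV (P n) >-> nat}) :
  let V := fun t : R => t `^ alpha / L t in
  let a := fun n : nat => (gen_inverse V n%:R)^-1 in
  let S := fun (n : nat) (w : Omega n) => (\sum_(i < n) X n i w)%N in
  let Y := fun n : nat => thin (S n) (fun i => eps n i) in
  0 < alpha -> alpha < 1 ->
  (forall t : R, 0 < t ->
     mu [set k : nat | t < k%:R] = (t `^ (- alpha) * L t)%:E) ->
  slowly_varying L ->
  tempering_function alpha q ->
  temper_const mu q l @[l --> +oo] --> (1 : R) ->
  lebesgue_measure.-negligible (discontinuities q) ->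
  (forall n, 0 < ell n) ->
  ell n @[n --> \oo] --> +oo ->
  (\forall n \near \oo,
     (forall (i : 'I_n) (A : set nat),
        P n (X n i @^-1` A) = tempered mu q (ell n) A) /\
     mutually_independent (P n) (fun i : 'I_n => X n i : Omega n -> nat)) ->
  (\forall n \near \oo, thinning_noise (a n) (S n) (eps n)) ->
  [/\ forall c : R, 0 < c -> a n * ell n @[n --> \oo] --> c ->
        forall nu : probability nat R, is_DTS alpha (rescale q c) alpha nu ->
          cvg_in_distribution P Y nu,
      a n * ell n @[n --> \oo] --> +oo ->
        forall nu : probability nat R, is_DS alpha alpha nu ->
          cvg_in_distribution P Y nu &
      forall zeta : R, a n * ell n @[n --> \oo] --> (0 : R) ->
        q x @[x --> +oo] --> zeta ->
        forall nu : probability nat R, is_DS alpha (alpha * zeta) nu ->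
          cvg_in_distribution P Y nu].
Proof.
move=> V a S Y alpha0 alpha1 mu_tail slowL tq temper1 Dnull ell0 elly lawX noise.
have [mq q0 [C qC] q1 _] := tq.
pose Q n v := tail_quantile mu n%:R v.
have by_ : gen_inverse V n%:R @[n --> \oo] --> +oo.
  exact: quantile_cvg_pinfty mu_tail slowL.
have Qb v : 0 < v -> (Q n v)%:R / gen_inverse V n%:R @[n --> \oo] --> v `^ (- alpha^-1).
  exact: tail_quantile_cvg alpha0 mu_tail slowL v.
have QlE v : \forall n \near \oo, (Q n v)%:R / gen_inverse V n%:R * (a n * ell n)^-1 =
    (Q n v)%:R / ell n.
  near=> n; have b0 : 0 < gen_inverse V n%:R.
    by near: n; move/cvgryPgt : by_; apply.
  by rewrite /a invfM invrK mulrA divfK// gt_eqF.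
have Qpos v : 0 < v -> \forall n \near \oo, 0 < (Q n v)%:R / ell n.
  move=> v0; have p0 : 0 < v `^ (- alpha^-1) by rewrite powR_gt0.
  near=> n; have : 0 < (Q n v)%:R / gen_inverse V n%:R.
    by near: n; exact: cvgr_gt (Qb v v0) _ p0.
  have b0 : 0 < gen_inverse V n%:R by near: n; move/cvgryPgt : by_; apply.
  by rewrite !pmulr_lgt0 ?invr_gt0.
have al_gt0 : \forall n \near \oo, 0 < a n * ell n.
  near=> n; have b0 : 0 < gen_inverse V n%:R by near: n; move/cvgryPgt : by_; apply.
  by rewrite mulr_gt0// invr_gt0.
have posP (v : R) : (`]0, +oo[%classic : set R) v -> 0 < v.
  by rewrite /= in_itv/= andbT.
have main := thinned_sum_cvg alpha0 alpha1 mu_tail slowL tq temper1 ell0 elly lawX noise.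
split.
(* regime [a n * ell n --> c]: continuity of [q] off its null set of discontinuities *)
- move=> c c0 alc nu nuDTS.
  have mqc : measurable_fun (`[0, +oo[ : set R) (rescale q c).
    rewrite (_ : rescale q c = q \o (fun x => x / c))//.
    apply: (measurable_comp (F := (`[0, +oo[%classic : set R))) => //.
      move=> _ [x x0 <-]; move: x0; rewrite /= !in_itv/= !andbT => x0.
      by rewrite divr_ge0// ltW.
    by apply: measurable_funTS; exact: measurable_funM.
  apply: (main (fun v => rescale q c (v `^ (- alpha^-1)))).
  + rewrite (_ : (fun v => _) = rescale q c \o (fun v => v `^ (- alpha^-1)))//.
    apply: (measurable_comp (F := (`[0, +oo[%classic : set R))) => //.
      by move=> _ [x x0 <-]; rewrite /= in_itv/= andbT powR_ge0.
    by apply: measurable_funTS; exact: measurable_powR.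
  + apply: negligibleS (negligible_power_subst alpha0 c0 Dnull) => v /= h.
    have [vpos nq] : (`]0, +oo[%classic : set R) v /\
        ~ (q ((Q n v)%:R / ell n) @[n --> \oo] --> rescale q c (v `^ (- alpha^-1))).
      by apply/not_implyP.
    have v0 := posP v vpos; split=> //; split.
      by rewrite divr_ge0 ?powR_ge0// ltW.
    apply: contra_not nq => qcont.
    apply: cvg_comp qcont; apply: cvg_within_comp; last first.
      by near=> n; rewrite /= in_itv/= andbT divr_ge0// ltW.
    have : (Q n v)%:R / gen_inverse V n%:R * (a n * ell n)^-1 @[n --> \oo] -->
        v `^ (- alpha^-1) / c.
      by apply: cvgM; [exact: Qb|apply: cvgV => //; rewrite gt_eqF].
    by apply: cvg_trans; apply: near_eq_cvg; exact: QlE.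
  + move=> s s0 s1; apply: pgf_DTS nuDTS s0 s1 => //.
    by move=> x x0; rewrite q0// divr_ge0// ltW.
(* regime [a n * ell n --> +oo]: the argument of [q] tends to 0 from the right *)
- move=> aly nu nuDS; apply: (main (fun=> 1)) => //.
  + apply: aeW => v vpos; have v0 := posP v vpos.
    apply: cvg_comp q1; apply: cvg_within_comp; last exact: Qpos.
    rewrite -[X in _ --> X](mulr0 (v `^ (- alpha^-1))).
    have : (Q n v)%:R / gen_inverse V n%:R * (a n * ell n)^-1 @[n --> \oo] -->
        v `^ (- alpha^-1) * 0.
      apply: cvgM; first exact: Qb.
      by apply/gtr0_cvgV0.
    by apply: cvg_trans; apply: near_eq_cvg; exact: QlE.
  + move=> s s0 s1; rewrite (@pgf_DS _ alpha 1)// ?mulr1// mul1r.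
    by congr (expR (- _)); apply: eq_Rintegral => v _; rewrite mul1r.
(* regime [a n * ell n --> 0]: the argument of [q] tends to infinity *)
- move=> zeta al0 qz nu nuDS; apply: (main (fun=> zeta)) => //.
  + apply: aeW => v vpos; have v0 := posP v vpos.
    apply: cvg_comp qz.
    have : (Q n v)%:R / gen_inverse V n%:R * (a n * ell n)^-1 @[n --> \oo] --> +oo.
      have p0 : 0 < v `^ (- alpha^-1) by rewrite powR_gt0.
      have p20 : 0 < v `^ (- alpha^-1) / 2 by rewrite divr_gt0.
      have p2p : v `^ (- alpha^-1) / 2 < v `^ (- alpha^-1).
        by rewrite ltr_pdivrMr// ltr_pMr// ltr1n.
      have aly : (a n * ell n)^-1 @[n --> \oo] --> +oo by apply/cvgrVy.
      apply/cvgryPge => A; near=> n.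
      have inv0 : 0 <= (a n * ell n)^-1.
        by near: n; move/cvgryPge : aly; apply.
      apply: (@le_trans _ _ (v `^ (- alpha^-1) / 2 * (a n * ell n)^-1)).
        rewrite mulrC -ler_pdivrMr//.
        by near: n; move/cvgryPge : aly; apply.
      rewrite ler_wpM2r// ltW//.
      by near: n; exact: cvgr_gt (Qb v v0) _ p2p.
    by apply: cvg_trans; apply: near_eq_cvg; exact: QlE.
  + move=> s s0 s1; rewrite (@pgf_DS _ alpha zeta)//.
    have u0 : 0 < 1 - s by rewrite subr_gt0.
    have u1 : 1 - s <= 1 by rewrite gerBl ltW.
    have [||||intg _] := @thinned_exponent_cvg _ _ _ _ (fun=> 1) alpha0 alpha1 mu_tail slowL 1
      _ _ ell (fun=> 1) _ ell0 u0 u1 => //.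
      by apply: aeW => v _; exact: cvg_cst.
    congr (expR (- _)); rewrite RintegralZl//.
    by apply: eq_integrable intg => // v _; rewrite /= mul1r.
Unshelve. all: by end_near.
Qed.
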